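(* Let $\mathbb{X},\mathbb{P}$ be Euclidean spaces, $f:\mathbb{X}\times\mathbb{P}\to\mathbb{R}\cup\{+\infty\}$, let $g:\mathbb{X}\to\mathbb{R}\cup\{+\infty\}$ be closed, proper, convex, and let $\bar p\in\mathbb{P}$. Suppose that $\bar x\in\operatorname{dom} f(\cdot,\bar p)\cap\operatorname{dom} g$ is an optimal solution of the problem $$\tilde P(\bar p):\qquad \min_{x\in\mathbb{X}}\ f(x,\bar p)+g(x),$$ that (A) $f(\cdot,\bar p)$ is a convex function, and that (B) $f$ is twice continuously differentiable (jointly in $(x,p)$) around $(\bar x,\bar p)$. Set $\bar z:=-\nabla_x f(\bar x,\bar p)\in\partial g(\bar x)$ and suppose that the Fenchel conjugate $g^*$ is $\mathcal{C}^2$-cone reducible at $\bar z$. Then the following are equivalent: (i) $\bar x$ is a fully stable optimal solution of $\tilde P(\bar p)$. (ii) $\bar x$ is a tilt stable optimal solution of $\tilde P(\bar p)$. (iii) $\ker\nabla^2_{xx}f(\bar x,\bar p)\cap\operatorname{par}\partial g^*(\bar z)=\{0\}$. Consequently, if additionally $f(\cdot,p)$ is convex for every $p\in\mathbb{P}$ around $\bar p$, then the solution mapping $$S(p):=\operatorname{argmin}\{f(x,p)+g(x)\,:\,x\in\mathbb{X}\}$$ is single-valued and Lipschitz continuous around $\bar p$ with $S(\bar p)=\bar x$, provided that the condition in (iii) is satisfied.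
   Context: A Euclidean space is a finite-dimensional real inner product space with the induced norm. A function is closed if its epigraph $\operatorname{epi} f=\{(x,\alpha): f(x)\le\alpha\}$ is closed, and proper if $\operatorname{dom} f=\{x: f(x)<+\infty\}\ne\emptyset$. The Fenchel conjugate is $g^*(y)=\sup_{x}\{\langle y,x\rangle-g(x)\}$; $\partial$ denotes the convex subdifferential; for a nonempty convex set $\Omega$, $\operatorname{par}\Omega:=\operatorname{span}(\Omega-x)$ for any $x\in\Omega$ (the parallel subspace). $\mathbb{B}_\gamma(\bar x)$ is the closed ball of radius $\gamma$ centered at $\bar x$. Full and tilt stability: put $\varphi(x,p):=f(x,p)+g(x)$ and, for $\gamma>0$, $v\in\mathbb{X}$, $p\in\mathbb{P}$, $$M_\gamma(v,p):=\operatorname{argmin}\{\varphi(x,p)-\langle v,x\rangle: x\in\mathbb{B}_\gamma(\bar x)\},\qquad m_\gamma(v,p):=\inf\{\varphi(x,p)-\langle v,x\rangle: x\in\mathbb{B}_\gamma(\bar x)\}.$$ The point $\bar x$ is a fully stable optimal solution of $\tilde P(\bar p)$ if there exists $\gamma>0$ such that $M_\gamma$ and $m_\gamma$ are single-valued and Lipschitz continuous on some neighborhood of $(0,\bar p)\in\mathbb{X}\times\mathbb{P}$ with $M_\gamma(0,\bar p)=\bar x$. It is a tilt stable optimal solution of $\tilde P(\bar p)$ if there exists $\gamma>0$ such that $M_\gamma(\cdot,\bar p)$ is single-valued and Lipschitz continuous on some neighborhood of $0\in\mathbb{X}$ with $M_\gamma(0,\bar p)=\bar x$. A set $\Theta\subset\mathbb{V}$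 ($\mathbb{V}$ Euclidean) is $\mathcal{C}^2$-cone reducible at $\bar v$ if there exist a neighborhood $V$ of $\bar v$, a pointed ($C\cap(-C)=\{0\}$), closed, convex cone $C$ in some Euclidean space $\mathbb{W}$, and a $\mathcal{C}^2$-smooth mapping $h:V\to\mathbb{W}$ such that $h(\bar v)=0$, the derivative $\mathcal{J}h(\bar v):\mathbb{V}\to\mathbb{W}$ is surjective, and $\Theta\cap V=\{v\in V: h(v)\in C\}$. A closed, proper, convex function $f$ is $\mathcal{C}^2$-cone reducible at $\bar u\in\operatorname{dom} f$ if $\operatorname{epi} f$ is $\mathcal{C}^2$-cone reducible at $(\bar u,f(\bar u))$. A set-valued mapping is ''single-valued and Lipschitz continuous around'' a point if there is a neighborhood of that point on which it takes exactly one value at each point and the resulting function is Lipschitz continuous. Singletons are identified with their element. *)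

(* Defs.v *)
(* Mathematical Components + MathComp-Analysis, over an abstract R : realType. *)
From HB Require Import structures.
From mathcomp Require Import all_boot all_order all_algebra.
From mathcomp Require Import all_classical all_reals all_analysis.

Set Implicit Arguments.
Unset Strict Implicit.
Unset Printing Implicit Defensive.

Import Order.TTheory GRing.Theory Num.Theory.
Import numFieldNormedType.Exports.

Local Open Scope classical_set_scope.
Local Open Scope ring_scope.

(* Euclidean spaces: finite-dimensional (Vector) normed modules whose norm is
   induced by an inner product; positivity and definiteness of [inner] follow
   from [inner_norm] and the norm axioms. *)
HB.mixin Record NormedModule_isEuclidean (R : realType) V
    of NormedModule R V & Vector R V := {
  inner : V -> V -> R ;
  innerC : forall u v, inner u v = inner v u ;
  innerP : forall (a : R) u v w,
    inner (a *: u + v) w = a * inner u w + inner v w ;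
  inner_norm : forall v : V, inner v v = `|v| ^+ 2
}.

#[short(type="euclidType")]
HB.structure Definition Euclidean (R : realType) :=
  { V of NormedModule_isEuclidean R V & NormedModule R V & Vector R V }.

Section Calculus.
Context {R : realType}.

(* Continuity of [y |-> 'd h y] is tested pointwise on directions [v]; on a
   finite-dimensional [V] this is continuity for the operator norm. *)
Definition C1_on {V W : normedModType R} (h : V -> W) (U : set V) : Prop :=
  forall x, U x -> differentiable h x /\
    forall v, {for x, continuous (fun y => 'd h y v)}.

Definition C2_on {V W : normedModType R} (h : V -> W) (U : set V) : Prop :=
  (forall x, U x -> differentiable h x) /\
  forall v, C1_on (fun y => 'd h y v) U.

(* The Riesz representative of ['d h x]; see [gradE]. *)
Definition grad {X : euclidType R} (h : X -> R) (x : X) : X :=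
  xget 0 [set z | forall v, 'd h x v = inner z v].

Definition hess {X : euclidType R} (h : X -> R) (x : X) : X -> X :=
  'd (grad h) x.

(* There is a neighborhood of [a] on which [F] takes exactly one value and the
   resulting function is Lipschitz continuous. *)
Definition single_valued_lipschitz_around {V W : normedModType R}
    (F : V -> set W) (a : V) : Prop :=
  exists (U : set V) (s : V -> W),
    [/\ nbhs a U, forall q, U q -> F q = [set s q] &
        [lipschitz s q | q in U]].

End Calculus.

Section ConvexAnalysis.
Context {R : realType}.
Local Open Scope ereal_scope.

(* Functions with values in R `|` {+oo} are functions into [\bar R] that never
   take the value -oo. *)
Definition noNy {T : Type} (phi : T -> \bar R) : Prop :=
  forall x, phi x != -oo.

Definition dom {T : Type} (phi : T -> \bar R) : set T :=
  [set x | phi x < +oo].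

Definition epi {T : Type} (phi : T -> \bar R) : set (T * R) :=
  [set q | phi q.1 <= q.2%:E].

Definition closed_fun {V : normedModType R} (phi : V -> \bar R) : Prop :=
  closed (epi phi).

Definition proper_fun {T : Type} (phi : T -> \bar R) : Prop :=
  dom phi !=set0.

(* Meaningful for functions satisfying [noNy]; there is then no conflict in the
   sum, and the products [0 * +oo = 0] at [t = 0, 1] are harmless. *)
Definition convex_fun {V : lmodType R} (phi : V -> \bar R) : Prop :=
  forall (x y : V) (t : R), (0 <= t <= 1)%R ->
    phi (t *: x + (1 - t) *: y)%R <= t%:E * phi x + (1 - t)%:E * phi y.

(* Empty when [phi] is identically +oo on [A]. *)
Definition argmin {T : Type} (phi : T -> \bar R) (A : set T) : set T :=
  [set x | [/\ A x, phi x < +oo & forall y, A y -> phi x <= phi y]].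

Definition conjugate {X : euclidType R} (phi : X -> \bar R) (y : X) : \bar R :=
  ereal_sup [set (inner y x)%:E - phi x | x in [set: X]].

Definition subdiff {X : euclidType R} (phi : X -> \bar R) (x : X) : set X :=
  [set z | phi x \is a fin_num /\
           forall y, phi x + (inner z (y - x)%R)%:E <= phi y].

(* span (Omega - x) for x in Omega; the choice of x is immaterial. *)
Definition par {V : vectType R} (Omega : set V) : set V :=
  [set v | exists2 x, Omega x &
     exists2 e : seq V, (forall u, u \in e -> Omega (u + x)%R) &
                        v \in <<e>>%VS].

End ConvexAnalysis.

Section ConeReducible.
Context {R : realType}.

Definition closed_convex_pointed_cone {W : normedModType R} (C : set W) : Prop :=
  [/\ closed C,
      convex_set (C : set (convex_lmodType W)),
      forall (a : R) w, 0 <= a -> C w -> C (a *: w) &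
      C `&` (-%R @` C) = [set 0]].

Definition C2_cone_reducible {V : normedModType R} (Theta : set V) (a : V)
    : Prop :=
  exists (U : set V) (W : euclidType R) (C : set W) (h : V -> W),
    [/\ open_nbhs a U, closed_convex_pointed_cone C, C2_on h U &
        [/\ h a = 0, forall w, exists v, 'd h a v = w &
            Theta `&` U = [set v | U v /\ C (h v)]]].

Definition C2_cone_reducible_fun {V : normedModType R} (phi : V -> \bar R)
    (u : V) : Prop :=
  phi u \is a fin_num /\ C2_cone_reducible (epi phi) (u, fine (phi u)).

End ConeReducible.

Section Stability.
Context {R : realType} {X P : euclidType R}.
Context (f : X * P -> \bar R) (g : X -> \bar R).
Local Open Scope ereal_scope.

Definition tilted (v : X) (p : P) (x : X) : \bar R :=
  f (x, p) + g x - (inner v x)%:E.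

Definition Mgamma (xbar : X) (gamma : R) (q : X * P) : set X :=
  argmin (tilted q.1 q.2) (closed_ball xbar gamma).

Definition mgamma (xbar : X) (gamma : R) (q : X * P) : \bar R :=
  ereal_inf [set tilted q.1 q.2 x | x in closed_ball xbar gamma].

Definition fully_stable (pbar : P) (xbar : X) : Prop :=
  exists2 gamma : R, (0 < gamma)%R &
    [/\ single_valued_lipschitz_around (Mgamma xbar gamma) (0%R, pbar),
        single_valued_lipschitz_around
          (fun q => [set r : R | mgamma xbar gamma q = r%:E]) (0%R, pbar) &
        Mgamma xbar gamma (0%R, pbar) = [set xbar]].

Definition tilt_stable (pbar : P) (xbar : X) : Prop :=
  exists2 gamma : R, (0 < gamma)%R &
    single_valued_lipschitz_around (fun v => Mgamma xbar gamma (v, pbar)) 0%R /\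
    Mgamma xbar gamma (0%R, pbar) = [set xbar].

Definition solution_map (p : P) : set X :=
  argmin (fun x => f (x, p) + g x) [set: X].

End Stability.

Section Riesz.
Context {R : realType} {X : euclidType R}.

Lemma riesz (l : {linear X -> R}) : exists z : X, forall v, l v = inner z v.
Proof.
have inner0l (w : X) : inner 0 w = 0 :> R.
  by have := innerP 1 0 0 w; rewrite scale1r addr0 mul1r -[LHS]addr0 => /addrI.
have innerZl (a : R) (u w : X) : inner (a *: u) w = a * inner u w.
  by rewrite -[a *: u]addr0 innerP inner0l addr0.
have innerDl (u v w : X) : inner (u + v) w = inner u w + inner v w.
  by rewrite -[u]scale1r innerP scale1r mul1r.
have innerDr (u v w : X) : inner u (v + w) = inner u v + inner u w :> R.
  by rewrite innerC innerDl [inner v _]innerC [inner w _]innerC.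
have innerZr (a : R) (u w : X) : inner u (a *: w) = a * inner u w.
  by rewrite innerC innerZl innerC.
pose n := \dim {:X}; pose b := vbasis {:X}.
pose phi (z : X) : 'rV[R]_n := \row_i inner z b`_i.
have phil : linear phi.
  by move=> a u v; apply/rowP => i; rewrite !mxE innerP.
pose phiL : {linear X -> 'rV[R]_n} :=
  HB.pack phi (GRing.isLinear.Build R X 'rV[R]_n _ phi phil).
have bE (v : X) : v = \sum_(i < n) coord b i v *: b`_i.
  by apply: coord_vbasis; rewrite memvf.
have inj : lker (linfun phiL) == 0%VS.
  apply/lker0P => u v /eqP; rewrite !lfunE /= -subr_eq0 => /eqP h.
  apply/eqP; rewrite -subr_eq0 -normr_eq0 -sqrf_eq0 -inner_norm.
  have hi (i : 'I_n) : inner (u - v) b`_i = 0 :> R.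
    have := congr1 (fun r : 'rV[R]_n => r 0 i) h.
    rewrite !mxE => <-; rewrite innerDl -[- v]scaleN1r innerZl mulN1r.
    by [].
  rewrite {2}[u - v]bE; apply/eqP.
  apply: (big_ind (fun w => inner (u - v) w = 0)) => [|x y hx hy|i _].
  - by rewrite innerC inner0l.
  - by rewrite innerDr hx hy addr0.
  by rewrite innerZr hi mulr0.
have full : limg (linfun phiL) = fullv.
  apply/eqP; rewrite eqEdim subvf /= limg_dim_eq ?(eqP inj) ?capv0 //.
  by rewrite !dimvf (leq_trans (eq_leq (dim_matrix R 1 n))) //
             {1}/n dimvf [leqLHS]mul1r.
have /memv_imgP [z _ zE] : (\row_i l b`_i) \in limg (linfun phiL).
  by rewrite full memvf.
exists z => v; rewrite [v]bE; rewrite lfunE /= in zE.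
transitivity (\sum_(i < n) inner z (coord b i v *: b`_i)); last first.
  elim/big_rec2: _ => [|i x y _ IH]; first by rewrite innerC inner0l.
  by rewrite innerDr IH.
rewrite linear_sum; apply: eq_bigr => i _.
rewrite linearZ innerZr; congr (_ * _).
by have := congr1 (fun r : 'rV[R]_n => r 0 i) zE; rewrite !mxE.
Qed.

Lemma gradE (h : X -> R) (x v : X) : 'd h x v = inner (grad h x) v.
Proof.
rewrite /grad; case: xgetP => [z -> ->//|/= H].
by have [z zE] := riesz ('d h x); have /(_ zE) := H z.
Qed.

End Riesz.

(* Main.v *)
(* Let [L] be the parallel subspace of the subdifferential [F] of the conjugate
   of [g] at [zbar], and [H] the Hessian of [f (., pbar)] at [xbar].

   Tilt stability implies (iii): an element of [L] is a multiple of [a - b] with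
   [a, b] in [F].  The segments from [xbar] to [a] and to [b] lie in [F], hence
   consist of minimisers for the tilts [grad f + zbar].  If [H (a - b) = 0], these
   tilts coincide up to [o(t)] at parameter [t], while the minimisers differ by
   [t (a - b)]; Lipschitz continuity gives [a = b].

   (iii) implies full stability: near [(zbar, conjugate g zbar)] the epigraph is
   [h^-1 C], so that every subgradient [x] of the conjugate at [z] satisfies
   [(x, -1) = (h' v)^* l] with a bounded multiplier [l] (Lyusternik), and, [C]
   being pointed, its polar spans, which identifies [L] with the range of
   [(h' vbar)^*] on horizontal vectors.  As [h'] is Lipschitz, two such
   subgradients differ by an element of [L] up to
   [eps |x - x'| + K |z - z'|].  Writing [z = v - grad_x f (x, p)] for two
   solutions, monotonicity of the subdifferential of [g] makes
   [<H (x - x'), x - x'>] small, hence [H (x - x')] since [H] is symmetric and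
   positive semidefinite, hence [x - x'] since [H] is injective on [L]. *)
From HB Require Import structures.
Require Import Defs.
From mathcomp Require Import all_boot all_order all_algebra.
From mathcomp Require Import all_classical all_reals all_analysis.
From mathcomp Require Import ring lra.
Set Implicit Arguments.
Unset Strict Implicit.
Unset Printing Implicit Defensive.
Import Order.TTheory GRing.Theory Num.Theory.
Import numFieldNormedType.Exports.
Local Open Scope classical_set_scope.
Local Open Scope ring_scope.

(** * Euclidean spaces and compactness *)

(** Away from [pbar] the functions [f (., p)] need not be convex, so minimisers over a ball are not
    unique by convexity. Uniqueness and Lipschitz continuity are both read off one estimate between
    pairs (subgradient, point), uniqueness being the case of equal data. Fermat's rule still
    applies, since it only uses convexity of [g]. The ball supplies existence, and a gap in value on
    its sphere keeps minimisers interior.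

    That a segment of subgradients of the conjugate consists of minimisers needs a return from the
    conjugate to [g]; a proximal minimisation provides it, without separation of epigraphs.

    Monotonicity only gives a quadratic bound: with [u = x - x'] and [d] the size of the data
    increment, [<H u, u> <= |u| (e |u| + m d)], so [|H u|] is of order [sqrt e |u| + sqrt (|u| d)].
    Small [e] absorbs the first term and Young's inequality splits the second, which restores a
    bound linear in [d].

    The difference of two multipliers induces a functional on [X * R] whose vertical part is small
    but not zero; it is removed with a multiple of [(xbar, -1)]. *)

Lemma small_scale (R : realType) (b m : R) : 0 < b -> 0 < m ->
  exists2 t : R, 0 < t & t <= 1 /\ t * b < m.
Proof.
move=> b0 m0; exists (Num.min 1 (m / b / 2)).
  by rewrite lt_min ltr01/= !divr_gt0.
split; first by rewrite ge_min lexx.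
apply: (@le_lt_trans _ _ (m / b / 2 * b)).
  by rewrite ler_pM2r// ge_min lexx orbT.
by rewrite mulrAC divfK ?gt_eqF//; lra.
Qed.

Section Inner.
Context {R : realType} {X : euclidType R}.
Implicit Types (u v w : X) (a : R).

Lemma innerDl u v w : inner (u + v) w = inner u w + inner v w.
Proof. by rewrite -[u]scale1r innerP scale1r mul1r. Qed.

Lemma inner0l w : inner 0 w = 0 :> R.
Proof. by apply: (@addrI _ (inner 0 w)); rewrite -innerDl !addr0. Qed.

Lemma innerZl a u w : inner (a *: u) w = a * inner u w.
Proof. by rewrite -[a *: u]addr0 innerP inner0l addr0. Qed.

Lemma innerNl u w : inner (- u) w = - inner u w.
Proof. by rewrite -scaleN1r innerZl mulN1r. Qed.

Lemma innerBl u v w : inner (u - v) w = inner u w - inner v w.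
Proof. by rewrite innerDl innerNl. Qed.

Lemma innerDr w u v : inner w (u + v) = inner w u + inner w v.
Proof. by rewrite innerC innerDl !(innerC _ w). Qed.

Lemma inner0r w : inner w 0 = 0 :> R.
Proof. by rewrite innerC inner0l. Qed.

Lemma innerZr a w u : inner w (a *: u) = a * inner w u.
Proof. by rewrite innerC innerZl innerC. Qed.

Lemma innerNr w u : inner w (- u) = - inner w u.
Proof. by rewrite innerC innerNl innerC. Qed.

Lemma innerBr w u v : inner w (u - v) = inner w u - inner w v.
Proof. by rewrite innerDr innerNr. Qed.

Lemma inner_linear w : linear (inner w : X -> R^o).
Proof. by move=> a u v; rewrite innerDr innerZr. Qed.

HB.instance Definition _ w :=
  GRing.isLinear.Build R X R^o _ (inner w : X -> R^o) (inner_linear w).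

(** Cauchy-Schwarz: the squared norm of [|v|^2 u - <u,v> v] equals
    [|v|^2 (|u|^2 |v|^2 - <u,v>^2)]. *)
Lemma norm_inner_le u v : `|inner u v| <= `|u| * `|v|.
Proof.
have [->|v0] := eqVneq v 0; first by rewrite inner0r normr0 mulr_ge0.
have nv : 0 < `|v| by rewrite normr_gt0.
rewrite -ler_sqr ?nnegrE ?mulr_ge0//.
rewrite exprMn real_normK ?num_real//.
have := sqr_ge0 `| `|v| ^+ 2 *: u - inner u v *: v |.
rewrite -inner_norm !(innerBl, innerBr, innerZl, innerZr) !inner_norm.
rewrite (innerC v u).
set s := inner u v; set x := `|u|; set y := `|v|.
move=> h; rewrite -subr_ge0 -(pmulr_rge0 _ (exprn_gt0 2 nv)) -/y.
by apply: le_trans h _; rewrite le_eqVlt; apply/orP; left; apply/eqP; ring.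
Qed.

Lemma ler_inner u v : inner u v <= `|u| * `|v|.
Proof. exact: le_trans (ler_norm _) (norm_inner_le u v). Qed.

Lemma inner_eq u v : (forall w, inner u w = inner v w) -> u = v.
Proof.
move=> uv; apply/eqP; rewrite -subr_eq0 -normr_eq0 -sqrf_eq0 -inner_norm.
by rewrite {1}innerBl uv subrr.
Qed.

Lemma sqr_normB u v : `|u - v| ^+ 2 = `|u| ^+ 2 - 2 * inner u v + `|v| ^+ 2.
Proof.
by rewrite -!inner_norm !innerBl !innerBr (innerC v u); ring.
Qed.

Lemma ler_norm_inner u (K : R) : 0 <= K ->
  (forall w, inner u w <= K * `|w|) -> `|u| <= K.
Proof.
move=> K0 /(_ u); rewrite inner_norm expr2.
have [->|u0] := eqVneq u 0; first by rewrite normr0.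
by rewrite ler_pM2r// normr_gt0.
Qed.

End Inner.

Section Frame.
Context {R : realType}.

(* The vectors [d i] form the dual basis of the basis [b] for the inner
   product. *)
Lemma dual_basis (X : euclidType R) : exists (n : nat) (b d : 'I_n -> X),
  forall w, w = \sum_i inner (d i) w *: b i.
Proof.
pose b := vbasis {:X}.
have /choice[d dE] (i : 'I_(\dim {:X})) :
    exists z : X, forall v, coord b i v = inner z v.
  exact: (@riesz R X (coord b i : {linear X -> R})).
exists (\dim {:X}), (fun i => b`_i), d => w.
rewrite {1}[w](coord_vbasis (memvf w)).
by apply: eq_bigr => i _; rewrite dE.
Qed.

(* A finite-dimensionality condition that, unlike a [vectType] structure, is
   directly available on the product spaces of the statement. *)
Definition finite_frame (V : normedModType R) : Prop :=
  exists (n : nat) (b : 'I_n -> V) (c : 'I_n -> V -> R) (K : R),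
    [/\ 0 <= K, forall v, v = \sum_i c i v *: b i &
        forall i v, `|c i v| <= K * `|v|].

Lemma finite_frame_euclid (X : euclidType R) : finite_frame X.
Proof.
have [n [b [d bd]]] := dual_basis X.
exists n, b, (fun i => inner (d i)), (\sum_i `|d i|); split => //.
  by rewrite sumr_ge0.
move=> i v; apply: le_trans (norm_inner_le _ _) _.
by rewrite ler_wpM2r// (bigD1 i)//= lerDl sumr_ge0.
Qed.

Lemma finite_frame_real : finite_frame R.
Proof.
exists 1%N, (fun=> 1), (fun _ v => v), 1; split => // [v|i v].
  by rewrite big_ord_recl big_ord0 addr0 /GRing.scale/= mulr1.
by rewrite mul1r.
Qed.

Lemma finite_frame_prod (V W : normedModType R) :
  finite_frame V -> finite_frame W -> finite_frame (V * W)%type.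
Proof.
move=> [n [b [c [K [K0 bc cK]]]]] [m [b' [c' [K' [K'0 bc' cK']]]]].
pose B i := match fintype.split i with inl j => (b j, 0) | inr j => (0, b' j) end.
pose C i (v : V * W) :=
  match fintype.split i with inl j => c j v.1 | inr j => c' j v.2 end.
have sp1 j : fintype.split (lshift m j) = inl j :> 'I_n + 'I_m.
  by rewrite -[lshift m j]/(unsplit (inl j)) unsplitK.
have sp2 j : fintype.split (rshift n j) = inr j :> 'I_n + 'I_m.
  by rewrite -[rshift n j]/(unsplit (inr j)) unsplitK.
exists (n + m)%N, B, C, (K + K'); split; first exact: addr_ge0.
  move=> [v w]; rewrite big_split_ord/=.
  rewrite (eq_bigr (fun i => (c i v *: b i, 0 : W))); last first.
    by move=> i _; rewrite /B /C sp1 -[in RHS](scaler0 _ (c i v)).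
  rewrite [X in _ + X](eq_bigr (fun i => (0 : V, c' i w *: b' i))); last first.
    by move=> i _; rewrite /B /C sp2 -[in RHS](scaler0 _ (c' i w)).
  have s1 p (F : 'I_p -> V) (G : 'I_p -> W) :
      \sum_i (F i, G i) = (\sum_i F i, \sum_i G i).
    by elim/big_rec3: _ => // i x y z _ ->.
  rewrite !s1 !big1_eq -bc -bc'; congr pair; last by rewrite add0r.
  by rewrite addr0.
move=> i [v w]; rewrite /C; case: fintype.split => j /=.
  rewrite (le_trans (cK _ _))// mulrDl prod_normE/= -[leLHS]addr0 lerD//.
    by rewrite ler_wpM2l// le_max lexx.
  by rewrite mulr_ge0.
rewrite (le_trans (cK' _ _))// mulrDl prod_normE/= -[leLHS]add0r lerD//.
  by rewrite mulr_ge0.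
by rewrite ler_wpM2l// le_max lexx orbT.
Qed.

Lemma finite_linear_bounded (V W : normedModType R) : finite_frame V ->
  forall A : {linear V -> W}, exists2 K : R, 0 < K &
    forall v, `|A v| <= K * `|v|.
Proof.
move=> [n [b [c [K [K0 bc cK]]]]] A.
exists (\sum_i K * `|A (b i)| + 1).
  by rewrite ltr_wpDl// sumr_ge0// => i _; rewrite mulr_ge0.
move=> v; rewrite {1}[v]bc linear_sum mulrDl mul1r.
apply: le_trans (ler_norm_sum _ _ _) _.
apply: (@le_trans _ _ ((\sum_i K * `|A (b i)|) * `|v|)); last by rewrite lerDl.
rewrite mulr_suml ler_sum// => i _.
by rewrite linearZ normrZ mulrAC ler_wpM2r.
Qed.

Lemma finite_linear_continuous (V W : normedModType R) :
  finite_frame V -> forall A : {linear V -> W}, continuous A.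
Proof.
move=> Vf A; have [K K0 AK] := finite_linear_bounded Vf A => x.
apply/cvgrPdist_lt => e e0; near=> y.
rewrite -linearB (le_lt_trans (AK _))// -ltr_pdivlMl//.
near: y; apply/nbhs_normP; exists (K^-1 * e) => //=.
by rewrite mulr_gt0// invr_gt0.
Unshelve. all: by end_near. Qed.

End Frame.

(** * Lower semicontinuity and attainment of minima *)

Section LowerSemicontinuity.
Context {R : realType}.
Local Open Scope ereal_scope.

Lemma lte_real_between (x y : \bar R) :
  x < y -> exists a : R, x < a%:E /\ a%:E < y.
Proof.
case: x y => [x||] [y||] //=.
- rewrite lte_fin => xy; exists ((x + y) / 2)%R.
  by rewrite !lte_fin; split; lra.
- by move=> _; exists (x + 1)%R; rewrite ltry lte_fin ltrDl.
- by move=> _; exists (y - 1)%R; rewrite ltNyr lte_fin gtrBl.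
- by move=> _; exists 0%R; rewrite ltNyr ltry.
Qed.

(** The nonempty strict sublevel sets form a filter base on [A], and any cluster point [x]
    minimises: a real level strictly between [psi y] and [psi x] gives a sublevel set that lower
    semicontinuity keeps away from [x]. If [psi] is [+oo] on all of [A] the base is empty, hence the
    separate case. *)
Lemma compact_lsc_min (T : topologicalType) (A : set T) (psi : T -> \bar R) :
  compact A -> A !=set0 ->
  (forall x a, A x -> a%:E < psi x -> \forall y \near x, A y -> a%:E < psi y) ->
  exists2 x, A x & forall y, A y -> psi x <= psi y.
Proof.
move=> cA [x0 Ax0] lsc.
have [[x1 Ax1 p1]|none] := pselect (exists2 x, A x & psi x < +oo); last first.
  exists x0 => // y Ay; rewrite leNgt; apply/negP => yx0.
  by apply: none; exists y => //; apply: lt_le_trans yx0 (leey _).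
have [a1 [xa1 _]] := lte_real_between p1.
pose D : set R := [set a | exists2 x, A x & psi x < a%:E].
pose B (a : R) : set T := [set x | A x /\ psi x < a%:E].
have Ff : Filter (filter_from D B).
  apply: filter_from_filter; first by exists a1, x1.
  move=> a b [x Ax xa] [y Ay yb]; exists (Num.min a b).
    have [ab|/ltW ba] := leP a b.
      by exists x => //.
    by exists y.
  by move=> z [Az]; rewrite EFin_min lt_min => /andP[za zb].
have Fp : ProperFilter (filter_from D B).
  by apply: filter_from_proper => // a [x Ax xa]; exists x.
have [x [Ax clx]] := cA _ Fp (ex_intro2 _ _ a1 (ex_intro2 _ _ x1 Ax1 xa1)
  (fun z (h : B a1 z) => proj1 h)).
exists x => // y Ay; rewrite leNgt; apply/negP => yx.
have [a [ya ax]] := lte_real_between yx.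
have [z [[Az za] /(_ Az) az]] :=
  clx (B a) _ (ex_intro2 _ _ a (ex_intro2 _ _ y Ay ya) (fun z h => h))
      (lsc x a Ax ax).
by have := lt_trans za az; rewrite ltxx.
Qed.

Lemma closed_fun_lsc (V : normedModType R) (g : V -> \bar R) (x : V) (a : R) :
  closed_fun g -> a%:E < g x -> \forall y \near x, a%:E < g y.
Proof.
move=> /closed_openC cg ax.
have [[U W] /= [Ux Wa] UW] : nbhs (x, a) (~` epi g).
  by apply: open_nbhs_nbhs; split => //; rewrite /setC /epi /=; apply/negP; rewrite -ltNge.
apply: filterS Ux => y Uy; rewrite ltNge; apply/negP => ya.
by apply: (UW (y, a)) => //; split => //=; exact: nbhs_singleton Wa.
Qed.

Lemma closed_fun_add_min (V : normedModType R) (g : V -> \bar R)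
    (k : V -> R) (A : set V) :
  closed_fun g -> noNy g -> compact A -> A !=set0 ->
  (forall x, A x -> {for x, continuous k}) ->
  exists2 x, A x & forall y, A y -> g x + (k x)%:E <= g y + (k y)%:E.
Proof.
move=> cg gN cA A0 ck; apply: compact_lsc_min => // x a Ax axk.
have : (a - k x)%:E < g x.
  move: axk (gN x); case: (g x) => [r axk _|_ _|] //=; last exact: ltry.
  move: axk.
  by rewrite -EFinD !lte_fin; lra.
move=> /lte_real_between[b []]; rewrite lte_fin => ab bx.
have e0 : (0 < b - (a - k x))%R by lra.
have := closed_fun_lsc cg bx.
have /cvgrPdist_lt/(_ _ e0) := ck x Ax.
apply: filterS2 => y; rewrite ltr_distlC => /andP[k1 k2] + _.
move: (gN y); case: (g y) => [r _|_ _|]//=; last exact: ltry.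
by rewrite -EFinD !lte_fin; lra.
Qed.

End LowerSemicontinuity.

Lemma continuous_sum (R : realType) (T : topologicalType)
    (V : normedModType R) n (F : 'I_n -> T -> V) (x : T) :
  (forall i, {for x, continuous (F i)}) ->
  {for x, continuous (fun y => \sum_i F i y)}.
Proof.
move=> Fc; rewrite -fct_sumE.
apply: (big_ind (fun f : T -> V => {for x, continuous f})) => //.
  exact: cst_continuous.
by move=> f f' fc fc'; exact: continuousD.
Qed.

Section Compactness.
Context {R : realType} {X : euclidType R}.

(** Heine-Borel is transported from row vectors: coordinates are inner products with the dual basis,
    so [A] is the continuous image of a closed bounded set of coordinates. *)
Lemma closed_bounded_compact (A : set X) (M : R) :
  closed A -> (forall x, A x -> `|x| <= M) -> compact A.
Proof.
move=> cA AM.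
have [n [b [d bd]]] := dual_basis X.
pose T (r : 'rV[R]_n) : X := \sum_i r 0 i *: b i.
have Tc : continuous T.
  move=> r; apply: continuous_sum => i.
  by apply: continuousZr_tmp; exact: coord_continuous.
pose K := \sum_i `|d i|.
pose B : set 'rV[R]_n := T @^-1` A `&`
  \bigcap_i [set r : 'rV[R]_n | `|r 0 i| <= K * `|M|].
have TB : T @` B = A.
  apply/seteqP; split => [_ [r [Ar _] <-]//|x Ax].
  exists (\row_i inner (d i) x).
    split => [|i _].
      rewrite /preimage/= /T.
      by under eq_bigr do rewrite mxE; rewrite -bd.
    rewrite /= mxE (le_trans (norm_inner_le _ _))// ler_pM//.
      by rewrite /K (bigD1 i)//= lerDl sumr_ge0.
    by rewrite (le_trans (AM _ Ax))// ler_norm.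
  by rewrite /T; under eq_bigr do rewrite mxE; rewrite -bd.
rewrite -TB; apply: continuous_compact; first exact: continuous_subspaceT.
apply: bounded_closed_compact.
  exists (K * `|M|); split; first exact: num_real.
  move=> e Me r [_ rB]; rewrite /Num.norm/= mx_normrE.
  apply/bigmax_leP; split; first by rewrite (le_trans _ (ltW Me))// mulr_ge0// sumr_ge0.
  by move=> [i j] _ /=; rewrite (ord1 i) (le_trans (rB _ _))// ltW.
apply: closedI; first by apply: preimage_closed => // *; exact: Tc.
apply: closed_bigI => i _.
apply: (@closed_comp _ _ (fun r : 'rV[R]_n => `|r 0 i|)
  [set x | x <= K * `|M|]); last exact: closed_le.
move=> r _; apply: (@continuous_comp _ _ _
  (fun r : 'rV[R]_n => r 0 i) Num.norm); first exact: coord_continuous.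
exact: norm_continuous.
Qed.

End Compactness.

(** * Differential calculus *)

Section Approximation.
Context {R : realType} {V W : normedModType R}.
Implicit Types (F : V -> W) (U : set V) (a x y : V).

Lemma near_radius a (Q : V -> Prop) : (\forall y \near a, Q y) ->
  exists2 r : R, 0 < r & forall y, `|y - a| < r -> Q y.
Proof.
move=> /nbhs_normP[r /= r0 rQ]; exists r => // y ya.
by apply: rQ; rewrite /ball_/= distrC.
Qed.

Lemma near_radius2 a (P Q : V -> Prop) :
  (\forall y \near a, P y) -> (\forall y \near a, Q y) ->
  exists2 r : R, 0 < r & forall y, `|y - a| < r -> P y /\ Q y.
Proof. by move=> aP aQ; apply: near_radius; apply: filterS2 aP aQ. Qed.

Lemma radius_near a (Q : V -> Prop) (r : R) : 0 < r ->
  (forall y, `|y - a| < r -> Q y) -> \forall y \near a, Q y.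
Proof.
move=> r0 rQ; apply/nbhs_normP; exists r => //= y ya.
by apply: rQ; rewrite distrC.
Qed.

Lemma open_nbhs_near a U : open_nbhs a U -> \forall y \near a, U y.
Proof. exact: open_nbhs_nbhs. Qed.

Lemma diff_approx F a (e : R) : differentiable F a -> 0 < e ->
  \forall y \near a, `|F y - F a - 'd F a (y - a)| <= e * `|y - a|.
Proof.
move=> /diff_locallyP[_ /eqaddoP/(_ e)] /[apply] /near_radius[r r0 rP].
apply: (radius_near r0) => y ya.
have := rP (y - a); rewrite subr0 => /(_ ya).
by rewrite /shift/= !fctE/= subrK opprD addrA.
Qed.

Lemma diff_of_approx F a (A : {linear V -> W}) : continuous A ->
  (forall e : R, 0 < e ->
    \forall y \near a, `|F y - F a - A (y - a)| <= e * `|y - a|) ->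
  differentiable F a /\ 'd F a = A :> (V -> W).
Proof.
move=> cA FA.
have H : F \o shift a = cst (F a) + A +o_ 0 id.
  apply/eqaddoP => e /FA/near_radius[r r0 rP].
  apply: (radius_near r0) => y; rewrite subr0 => yr.
  have := rP (y + a); rewrite addrK => /(_ yr).
  by rewrite /shift/= !fctE/= opprD addrA.
have dA : 'd F a = A :> (V -> W) by exact: diff_unique.
by split => //; apply/diff_locallyP; rewrite dA.
Qed.

Lemma seg_ball x y a (r t : R) : 0 <= t <= 1 ->
  `|x - a| < r -> `|y - a| < r -> `|x + t *: (y - x) - a| < r.
Proof.
move=> /andP[t0 t1] xr yr.
have -> : x + t *: (y - x) - a = (1 - t) *: (x - a) + t *: (y - a).
  rewrite scalerBl scale1r -[RHS]addrA (addrC (- _)) -scalerBr.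
  by rewrite opprB addrA subrK addrAC.
apply: le_lt_trans (ler_normD _ _) _; rewrite !normrZ.
rewrite (ger0_norm t0) ger0_norm ?subr_ge0//.
move: xr yr; set p := `|x - a|; set q := `|y - a| => xr yr.
have [->|t01] := eqVneq t 0; first by rewrite subr0 mul0r mul1r addr0.
have : t * q < t * r by rewrite ltr_pM2l// lt_def t01.
have : (1 - t) * p <= (1 - t) * r by rewrite ler_wpM2l ?subr_ge0// ltW.
lra.
Qed.

End Approximation.

Section MeanValue.
Context {R : realType} {V : normedModType R}.
Implicit Types (F : V -> R) (U : set V) (a x y : V).

Lemma mean_value F x y :
  (forall t : R, 0 <= t <= 1 -> differentiable F (x + t *: (y - x))) ->
  exists2 t : R, 0 <= t <= 1 & F y - F x = 'd F (x + t *: (y - x)) (y - x).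
Proof.
move=> dF; pose v := y - x; pose l (t : R) : V := x + t *: v.
have dl (t : R) : is_diff t l (fun s => s *: v).
  have -> : l = cst x + ( *:%R ^~ v) by apply/funext.
  apply: is_diff_eq.
  by apply/funext => s; rewrite !fctE /= add0r.
have dphi (t : R) : 0 <= t <= 1 -> differentiable (F \o l) t.
  by move=> t01; apply: differentiable_comp; [exact: ex_diff|exact: dF].
have [||t t01] := @MVT_segment R (F \o l) (fun t => 'd F (l t) v) 0 1 ler01.
- move=> t; rewrite in_itv/= => /andP[t0 t1].
  have t01 : 0 <= t <= 1 by rewrite (ltW t0) (ltW t1).
  apply: DeriveDef; first exact/diff_derivable/dphi.
  rewrite deriveE; last exact: dphi.
  rewrite diff_comp//; last exact: dF.
  by rewrite /= diff_val scale1r.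
- apply: continuous_in_subspaceT => t; rewrite inE /= in_itv/= => t01.
  exact/differentiable_continuous/dphi.
have l1 : l 1 = y by rewrite /l scale1r addrC subrK.
have l0 : l 0 = x by rewrite /l scale0r addr0.
rewrite /= l1 l0 subr0 mulr1 => Fxy.
by exists t => //; move: t01; rewrite in_itv.
Qed.

End MeanValue.

Section ContinuouslyDifferentiable.
Context {R : realType}.

(** Upgrades the directionwise continuity in [C1_on] to uniformity over directions: only the
    finitely many frame vectors have to be controlled. *)
Lemma C1_diff_near (V W : normedModType R) (F : V -> W) (U : set V) (a : V)
    (e : R) : finite_frame V -> open_nbhs a U -> C1_on F U -> 0 < e ->
  \forall y \near a, forall v, `|'d F y v - 'd F a v| <= e * `|v|.
Proof.
move=> [n [b [c [K [K0 bc cK]]]]] aU C1F e0.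
have Ua : U a by case: aU.
pose e' := e / (n%:R * K + 1).
have nK : 0 < n%:R * K + 1 by rewrite ltr_wpDl// mulr_ge0.
have e'0 : 0 < e' by rewrite divr_gt0.
have : \forall y \near a, forall i, `|'d F y (b i) - 'd F a (b i)| <= e'.
  apply: filter_forall => i.
  have /cvgrPdist_le/(_ _ e'0) := (C1F a Ua).2 (b i).
  by apply: filterS => y; rewrite distrC.
apply: filterS => y yb v.
rewrite {1 2}[v]bc (linear_sum ('d F y)) (linear_sum ('d F a)) -sumrB.
apply: le_trans (ler_norm_sum _ _ _) _.
apply: (@le_trans _ _ (\sum_(i < n) e' * (K * `|v|))).
  apply: ler_sum => i _; rewrite (linearZ_LR ('d F y)) (linearZ_LR ('d F a)) -scalerBr normrZ mulrC.
  by apply: ler_pM.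
rewrite sumr_const card_ord -mulr_natl [leLHS](_ : _ = e' * (n%:R * K) * `|v|).
  by rewrite ler_wpM2r// /e' mulrAC ler_pdivrMr// ler_wpM2l ?lerDl// ltW.
by ring.
Qed.

Lemma C1_strict_diff_real (V : normedModType R) (F : V -> R) (U : set V)
    (a : V) (e : R) :
  finite_frame V -> open_nbhs a U -> C1_on F U -> 0 < e ->
  exists2 r : R, 0 < r & forall x y, `|x - a| < r -> `|y - a| < r ->
    `|F y - F x - 'd F a (y - x)| <= e * `|y - x|.
Proof.
move=> fV aU C1F e0.
have [r r0 rP] :=
  near_radius2 (open_nbhs_near aU) (C1_diff_near fV aU C1F e0).
exists r => // x y xr yr.
have [t t01 ->] : exists2 t : R, 0 <= t <= 1 &
    F y - F x = 'd F (x + t *: (y - x)) (y - x).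
  by apply: mean_value => t t01; apply: (C1F _ _).1; apply: (rP _ _).1;
     exact: seg_ball.
by apply: (rP _ _).2; exact: seg_ball.
Qed.

Lemma diff_inner (V : normedModType R) (W : euclidType R) (F : V -> W)
    (w : W) (x : V) : differentiable F x ->
  differentiable (fun z => inner w (F z)) x /\ forall v, 'd (fun z => inner w (F z)) x v = inner w ('d F x v).
Proof.
move=> dF.
have cw : continuous (inner w : W -> R^o).
  exact: (@finite_linear_continuous _ _ _ (finite_frame_euclid W)).
have dw z : differentiable (inner w : W -> R^o) z.
  exact: linear_differentiable.
have E : (fun z => inner w (F z)) = (inner w : W -> R^o) \o F by [].
split; first by rewrite E; exact: differentiable_comp.
by move=> v; rewrite E diff_comp// /= diff_lin.
Qed.

(** The mean value theorem is scalar, so it is applied to [<w, F>] with [w] the remainder to be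
    bounded; this gives [|w|^2 <= |w| e |y - x|]. *)
Lemma C1_strict_diff (V : normedModType R) (W : euclidType R) (F : V -> W)
    (U : set V) (a : V) (e : R) :
  finite_frame V -> open_nbhs a U -> C1_on F U -> 0 < e ->
  exists2 r : R, 0 < r & forall x y, `|x - a| < r -> `|y - a| < r ->
    `|F y - F x - 'd F a (y - x)| <= e * `|y - x|.
Proof.
move=> fV aU C1F e0.
have [r r0 rP] :=
  near_radius2 (open_nbhs_near aU) (C1_diff_near fV aU C1F e0).
exists r => // x y xr yr; set w := F y - F x - _.
have rU (t : R) : 0 <= t <= 1 -> U (x + t *: (y - x)).
  by move=> t01; apply: (rP _ _).1; exact: seg_ball.
have [t t01] : exists2 t : R, 0 <= t <= 1 &
    inner w (F y) - inner w (F x)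
    = 'd (fun z => inner w (F z)) (x + t *: (y - x)) (y - x).
  apply: (@mean_value _ _ (fun z => inner w (F z))) => t t01.
  by have [] := diff_inner w (C1F _ (rU _ t01)).1.
rewrite (diff_inner w (C1F _ (rU _ t01)).1).2 -innerBr => E.
have [->|w0] := eqVneq w 0; first by rewrite normr0 mulr_ge0// ltW.
have : `|w| ^+ 2 <= `|w| * (e * `|y - x|).
  rewrite -inner_norm {2}/w innerBr E -innerBr (le_trans (ler_inner _ _))//.
  by rewrite ler_wpM2l//; apply: (rP _ _).2; exact: seg_ball.
by rewrite expr2 ler_pM2l// normr_gt0.
Qed.

Lemma C1_lipschitz (V : normedModType R) (W : euclidType R) (F : V -> W)
    (U : set V) (a : V) :
  finite_frame V -> open_nbhs a U -> C1_on F U ->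
  exists2 r : R, 0 < r & exists2 K : R, 0 < K &
    forall x y, `|x - a| < r -> `|y - a| < r -> `|F y - F x| <= K * `|y - x|.
Proof.
move=> fV aU C1F.
have [r r0 rP] := C1_strict_diff fV aU C1F ltr01.
have [K K0 KP] := finite_linear_bounded fV ('d F a).
exists r => //; exists (K + 1) => [|x y xr yr]; first by rewrite addr_gt0.
rewrite -[F y - F x](subrK ('d F a (y - x))) addrC mulrDl.
by rewrite (le_trans (ler_normD _ _))// lerD// rP.
Qed.

Lemma C1_lipschitz_real (V : normedModType R) (F : V -> R)
    (U : set V) (a : V) :
  finite_frame V -> open_nbhs a U -> C1_on F U ->
  exists2 r : R, 0 < r & exists2 K : R, 0 < K &
    forall x y, `|x - a| < r -> `|y - a| < r -> `|F y - F x| <= K * `|y - x|.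
Proof.
move=> fV aU C1F.
have [r r0 rP] := C1_strict_diff_real fV aU C1F ltr01.
have [K K0 KP] := finite_linear_bounded fV ('d F a).
exists r => //; exists (K + 1) => [|x y xr yr]; first by rewrite addr_gt0.
rewrite -[F y - F x](subrK ('d F a (y - x))) addrC mulrDl.
by rewrite (le_trans (ler_normD _ _))// lerD// rP.
Qed.

Lemma C2_C1 (V W : normedModType R) (F : V -> W) (U : set V) :
  C2_on F U -> C1_on F U.
Proof.
move=> [dF d2F] x Ux; split; first exact: dF.
by move=> v; apply: differentiable_continuous; case: (d2F v x Ux).
Qed.

Lemma C2_diff_lipschitz (V : normedModType R) (W : euclidType R) (F : V -> W)
    (U : set V) (a : V) :
  finite_frame V -> open_nbhs a U -> C2_on F U ->
  exists2 r : R, 0 < r & exists2 K : R, 0 < K &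
    forall x y, `|x - a| < r -> `|y - a| < r ->
      forall v, `|'d F y v - 'd F x v| <= K * `|y - x| * `|v|.
Proof.
move=> fV aU [_ C2F]; have [n [b [c [K [K0 bc cK]]]]] := fV.
have /choice[rL rLP] (i : 'I_n) : exists rL : R * R, [/\ 0 < rL.1, 0 < rL.2 &
    forall x y, `|x - a| < rL.1 -> `|y - a| < rL.1 ->
      `|'d F y (b i) - 'd F x (b i)| <= rL.2 * `|y - x|].
  have [r r0 [L L0 rL]] := C1_lipschitz fV aU (C2F (b i)).
  by exists (r, L).
exists (\big[Num.min/1]_i (rL i).1).
  apply: (big_ind (fun r : R => 0 < r)) => // [r s r0 s0|i _].
    by rewrite lt_min r0.
  by have [] := rLP i.
exists (\sum_i (rL i).2 * K + 1).
  rewrite ltr_wpDl// sumr_ge0// => i _; rewrite mulr_ge0//.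
  by have [_ /ltW] := rLP i.
move=> x y xr yr v.
rewrite {1 2}[v]bc (linear_sum ('d F y)) (linear_sum ('d F x)) -sumrB.
apply: le_trans (ler_norm_sum _ _ _) _.
rewrite -mulrA mulrDl mul1r -[leLHS]addr0 lerD ?mulr_ge0//.
rewrite mulr_suml; apply: ler_sum => i _.
rewrite (linearZ_LR ('d F y)) (linearZ_LR ('d F x)) -scalerBr normrZ.
have [r0 L0 rL_] := rLP i.
have h : `|'d F y (b i) - 'd F x (b i)| <= (rL i).2 * `|y - x|.
  by apply: rL_; [move: xr|move: yr] => /lt_le_trans; apply; exact: bigmin_le.
apply: le_trans (ler_pM _ _ (cK i v) h) _ => //.
by rewrite le_eqVlt; apply/orP; left; apply/eqP; ring.
Qed.

End ContinuouslyDifferentiable.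

(** * The partial gradient in [x] and the Hessian of a slice *)

Section PartialGradient.
Context {R : realType} {X P : euclidType R}.
Implicit Types (F : X * P -> R) (U : set (X * P)).

Lemma norm_pair0 (V W : normedModType R) (v : V) : `|(v, 0 : W)| = `|v|.
Proof. by rewrite prod_normE/= normr0; apply/max_idPl. Qed.

Lemma subr_pair (V W : normedModType R) (x y : V) (p : W) :
  (x, p) - (y, p) = (x - y, 0).
Proof. by rewrite -[LHS]/(_, _)/= subrr. Qed.

Lemma linear_pair0 (V W Z : normedModType R) (A : {linear (V * W)%type -> Z}) :
  linear (fun v => A (v, 0)).
Proof.
move=> k u v; rewrite -linearP; congr (A _).
by rewrite -[RHS]/(_, _)/= scaler0 addr0.
Qed.

Lemma finite_frame_pair : finite_frame (X * P)%type.
Proof. by apply: finite_frame_prod; exact: finite_frame_euclid. Qed.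

(** Riesz applies at every [q], as ['d F q] is linear even where [F] is not differentiable.
    Smoothness of [G] is inherited from [G q = \sum_i 'd F q (d i, 0) *: b i], with [d] dual to
    [b]. *)
Lemma partial_gradient F U : open U -> C2_on F U ->
  exists2 G : X * P -> X, (forall q v, 'd F q (v, 0) = inner (G q) v) &
    C1_on G U.
Proof.
move=> oU [dF C2F].
have /choice[G GE] (q : X * P) :
    exists z : X, forall v, 'd F q (v, 0) = inner z v.
  pose l : {linear X -> R} := HB.pack (fun v => 'd F q (v, 0))
    (GRing.isLinear.Build R X R _ _ (linear_pair0 ('d F q))).
  exact: (riesz l).
exists G => //.
have [n [b [d bd]]] := dual_basis X.
have Gsum q : G q = \sum_i 'd F q (d i, 0) *: b i.
  by rewrite [LHS]bd; apply: eq_bigr => i _; rewrite GE innerC.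
have dG q : U q -> differentiable G q.
  move=> Uq; rewrite (_ : G = \sum_i (fun q => 'd F q (d i, 0) *: b i)).
    apply: differentiable_sum => i; apply: differentiableZl.
    by have [] := C2F (d i, 0) q Uq.
  by apply/funext => z; rewrite fct_sumE Gsum.
move=> q Uq; split; first exact: dG.
move=> v.
have dGE z : U z -> 'd G z v =
    \sum_i 'd (fun y => 'd F y (d i, 0)) z v *: b i.
  move=> Uz; rewrite [LHS]bd; apply: eq_bigr => i _; congr (_ *: _).
  rewrite -(diff_inner (d i) (dG z Uz)).2; congr ('d _ z v).
  by apply/funext => y; rewrite GE innerC.
have gE : 'd G q v = \sum_i 'd (fun y => 'd F y (d i, 0)) q v *: b i.
  exact: dGE.
apply: (@cvg_trans _ ((fun y => \sum_i
    'd (fun y => 'd F y (d i, 0)) y v *: b i) @ q)).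
  apply: near_eq_cvg; have := open_nbhs_near (conj oU Uq : open_nbhs q U).
  by apply: filterS => y Uy; rewrite dGE.
rewrite gE; apply: (@continuous_sum R _ X n
  (fun i y => 'd (fun y => 'd F y (d i, 0)) y v *: b i)) => i.
by apply: continuousZr_tmp; exact: (C2F (d i, 0) q Uq).2.
Qed.

Lemma slice_diff (W : normedModType R) (F : X * P -> W) (x : X) (p : P) :
  differentiable F (x, p) ->
  differentiable (fun y => F (y, p)) x /\
  forall v, 'd (fun y => F (y, p)) x v = 'd F (x, p) (v, 0).
Proof.
move=> dF.
pose A : {linear X -> W} := HB.pack (fun v => 'd F (x, p) (v, 0))
  (GRing.isLinear.Build R X W _ _ (linear_pair0 ('d F (x, p)))).
have [||dS SE] := @diff_of_approx R X W (fun y => F (y, p)) x A.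
- by apply: finite_linear_continuous; exact: finite_frame_euclid.
- move=> e e0; have /near_radius[r r0 rP] := diff_approx dF e0.
  apply: (radius_near r0) => y yr.
  by have := rP (y, p); rewrite subr_pair norm_pair0; apply.
by split => // v; rewrite SE.
Qed.

Lemma grad_slice F (G : X * P -> X) (x : X) (p : P) :
  (forall q v, 'd F q (v, 0) = inner (G q) v) -> differentiable F (x, p) ->
  grad (fun y => F (y, p)) x = G (x, p).
Proof.
move=> GE dF; apply: inner_eq => v.
by rewrite -gradE -GE (slice_diff dF).2.
Qed.

(** [hess] differentiates [grad] of the slice, which is known to equal [G (., p)] only where [F] is
    differentiable; equality near [x] is enough for the derivative. *)
Lemma hess_slice F (G : X * P -> X) (U : set (X * P)) (x : X) (p : P) (u : X) :
  (forall q v, 'd F q (v, 0) = inner (G q) v) -> open_nbhs (x, p) U ->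
  (forall q, U q -> differentiable F q) -> differentiable G (x, p) ->
  hess (fun y => F (y, p)) x u = 'd G (x, p) (u, 0).
Proof.
move=> GE xU dF dG.
pose A : {linear X -> X} := HB.pack (fun v => 'd G (x, p) (v, 0))
  (GRing.isLinear.Build R X X _ _ (linear_pair0 ('d G (x, p)))).
have Uxp : U (x, p) by case: xU.
have [||_ SE] := @diff_of_approx R X X (grad (fun y => F (y, p))) x A.
- by apply: finite_linear_continuous; exact: finite_frame_euclid.
- move=> e e0.
  have [r r0 rP] := near_radius2 (open_nbhs_near xU) (diff_approx dG e0).
  apply: (radius_near r0) => y yr.
  have := rP (y, p); rewrite subr_pair norm_pair0 => /(_ yr)[Uyp].
  by rewrite (grad_slice GE (dF _ Uyp)) (grad_slice GE (dF _ Uxp)).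
by rewrite /hess SE.
Qed.

End PartialGradient.

Section SymmetricHessian.
Context {R : realType} {X : euclidType R}.

Lemma strict_hessian_sym (phi : X -> R) (Gam : X -> X) (H : {linear X -> X})
    (a : X) :
  (\forall x \near a, differentiable phi x /\
     forall v, 'd phi x v = inner (Gam x) v) ->
  (forall e : R, 0 < e -> exists2 r : R, 0 < r &
     forall x y, `|x - a| < r -> `|y - a| < r ->
       `|Gam y - Gam x - H (y - x)| <= e * `|y - x|) ->
  forall u w, inner (H u) w = inner (H w) u.
Proof.
move=> /near_radius[r0 r00 dphi] strict.
(* The second difference [phi (a+u+w) - phi (a+u) - phi (a+w) + phi a] is
   symmetric in [u] and [w] and close to [inner (H u) w]. *)
have key e : 0 < e -> exists2 r : R, 0 < r &
    forall u w, `|u| + `|w| < r ->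
      `|phi (a + u + w) - phi (a + u) - phi (a + w) + phi a - inner (H u) w|
      <= e * `|u| * `|w|.
  move=> e0; have [r r_gt0 rP] := strict e e0.
  exists (Num.min r r0) => [|u w]; first by rewrite lt_min r_gt0.
  rewrite lt_min => /andP[uwr uwr0].
  have zu (t : R) : 0 <= t <= 1 ->
      `|a + t *: w + u - a| <= `|u| + `|w| /\
      `|a + t *: w - a| <= `|u| + `|w|.
    move=> /andP[t0 t1].
    have tw : `|t *: w| <= `|w| by rewrite normrZ ger0_norm// ler_piMl.
    split.
      rewrite addrAC [a + _]addrC addrK addrC.
      by rewrite (le_trans (ler_normD _ _))// lerD2l.
    by rewrite addrC addKr (le_trans tw)// lerDr.
  pose psi z := phi (z + u) - phi z.
  have dpsi z : `|z + u - a| < r0 -> `|z - a| < r0 -> differentiable psi z /\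
      forall v, 'd psi z v = inner (Gam (z + u) - Gam z) v.
    move=> zur zr; have [d1 d1E] := dphi _ zur; have [d2 d2E] := dphi _ zr.
    have ds : is_diff z (shift u) id.
      have -> : shift u = id + cst u by apply/funext.
      by apply: is_diff_eq; rewrite addr0.
    have d3 : differentiable (phi \o shift u) z.
      by apply: differentiable_comp => //; exact: ex_diff.
    split; first exact: (differentiableB d3 d2).
    move=> v; rewrite (_ : psi = phi \o shift u - phi)//.
    have dsv : 'd (shift u) z v = v by rewrite diff_val.
    by rewrite diffB// diff_comp// -[LHS]/('d phi (z + u) ('d (shift u) z v)
      - 'd phi z v) dsv d2E innerBl d1E.
  have [t t01 tE] : exists2 t : R, 0 <= t <= 1 &
      psi (a + w) - psi a
      = 'd psi (a + t *: (a + w - a)) (a + w - a).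
    apply: mean_value => t /zu[z1 z2]; rewrite [a + w]addrC addrK.
    by apply: (dpsi _ _ _).1; [exact: le_lt_trans z1 _|exact: le_lt_trans z2 _].
  move: tE; have [z1 z2] := zu t t01; rewrite [a + w]addrC addrK.
  rewrite (dpsi _ _ _).2; [|exact: le_lt_trans z1 _|exact: le_lt_trans z2 _].
  rewrite /psi => E.
  have -> : phi (a + u + w) - phi (a + u) - phi (w + a) + phi a
      = phi (w + a + u) - phi (w + a) - (phi (a + u) - phi a).
    by rewrite [w + a]addrC (addrAC a u); ring.
  rewrite E -innerBl (le_trans (norm_inner_le _ _))// ler_wpM2r//.
  have := rP (a + t *: w) (a + t *: w + u).
  rewrite [a + t *: w + u - (a + t *: w)]addrC addKr; apply.
    exact: le_lt_trans z2 _.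
  exact: le_lt_trans z1 _.
move=> u w; apply/eqP; rewrite -subr_eq0 -normr_le0.
apply/ler_addgt0Pr => e e0; rewrite add0r.
(* Scaling [u] and [w] by the same small [s] puts both orders of the second difference within reach
   of [key]; dividing by [s^2] leaves an error at most [2 (e / (2 m m)) |u| |w| <= e]. *)
pose m := `|u| + `|w| + 1.
have m0 : 0 < m by rewrite ltr_wpDl// addr_ge0.
have e'0 : 0 < e / (2 * m * m) by rewrite divr_gt0// !mulr_gt0.
have [r r_gt0 rP] := key _ e'0.
have [s s0 [_ sm]] := small_scale m0 r_gt0.
have sr : `|s *: u| + `|s *: w| < r.
  rewrite !normrZ (gtr0_norm s0) -mulrDr (le_lt_trans _ sm)//.
  by rewrite ler_wpM2l ?(ltW s0)// /m lerDl.
have h1 := rP _ _ sr.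
have h2 := rP (s *: w) (s *: u); rewrite [X in X < r]addrC in h2.
have {h2} h2 := h2 sr.
move: h1 h2; rewrite (addrAC a (s *: w)).
set D1 := phi (a + s *: u + s *: w); set D2 := phi (a + s *: u).
set D3 := phi (a + s *: w); rewrite !(linearZ_LR H) !innerZl !innerZr !normrZ.
rewrite (gtr0_norm s0).
set h := inner (H u) w; set k := inner (H w) u.
set E := e / _ => h1 h2.
have : `|s * (s * (h - k))| <= 2 * (E * (s * `|u|) * (s * `|w|)).
  have -> : s * (s * (h - k)) = (D1 - D3 - D2 + phi a - s * (s * k))
    - (D1 - D2 - D3 + phi a - s * (s * h)) by ring.
  rewrite (le_trans (ler_normB _ _))//; lra.
rewrite !normrM (gtr0_norm s0) => H1.
have : `|h - k| <= 2 * (E * `|u| * `|w|).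
  rewrite -(ler_pM2l s0) -(ler_pM2l s0) (le_trans H1)//.
  by rewrite le_eqVlt; apply/orP; left; apply/eqP; ring.
move=> /le_trans; apply.
have uw : `|u| * `|w| <= m * m.
  by rewrite ler_pM// /m; move: (normr_ge0 u) (normr_ge0 w); lra.
have -> : 2 * (E * `|u| * `|w|) = E * (2 * (`|u| * `|w|)) by ring.
have : E * (2 * (`|u| * `|w|)) <= E * (2 * (m * m)).
  by rewrite ler_pM2l// ler_pM2l.
suff <- : E * (2 * (m * m)) = e by [].
by rewrite /E (mulrA 2) divfK// gt_eqF// !mulr_gt0.
Qed.

End SymmetricHessian.

(** * Subdifferentials and conjugates *)

Section Subdifferential.
Context {R : realType} {X : euclidType R}.
Implicit Types (g phi : X -> \bar R) (x y z : X).

Lemma subdiffP phi x y z (a b : R) : subdiff phi x z ->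
  phi x = a%:E -> phi y = b%:E -> a + inner z (y - x) <= b.
Proof. by move=> [_ /(_ y)] + xa yb; rewrite xa yb -EFinD lee_fin. Qed.

Lemma subdiff_fin phi x z : subdiff phi x z -> exists a : R, phi x = a%:E.
Proof. by move=> [/fineK <- _]; exists (fine (phi x)). Qed.

Lemma subdiff_monotone phi x x' z z' : subdiff phi x z -> subdiff phi x' z' ->
  0 <= inner (x - x') (z - z').
Proof.
move=> zx zx'; have [a xa] := subdiff_fin zx; have [a' xa'] := subdiff_fin zx'.
have := subdiffP zx xa xa'; have := subdiffP zx' xa' xa.
rewrite !innerBr !innerBl !(innerC _ z) !(innerC _ z'); lra.
Qed.

Lemma subdiff_convex phi x z z' (t : R) : 0 <= t <= 1 ->
  noNy phi -> subdiff phi x z -> subdiff phi x z' ->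
  subdiff phi x (t *: z + (1 - t) *: z').
Proof.
move=> /andP[t0 t1] pN zx zx'; split=> [|y]; first by case: zx.
have [a xa] := subdiff_fin zx; move: (pN y).
case yb: (phi y) => [b||] // _; last by rewrite leey.
have := subdiffP zx xa yb; have := subdiffP zx' xa yb.
rewrite xa -EFinD lee_fin innerDl !innerZl => h1 h2.
have : t * (a + inner z (y - x)) <= t * b by rewrite ler_wpM2l.
have : (1 - t) * (a + inner z' (y - x)) <= (1 - t) * b.
  by rewrite ler_wpM2l// subr_ge0.
lra.
Qed.

(* Fermat's rule: perturbing [x] towards [y] and using the convexity of [g]
   turns local into global information. *)
Lemma convex_local_min_subdiff g (k : X -> R) x d :
  noNy g -> convex_fun g -> (g x < +oo)%E ->
  (forall e : R, 0 < e ->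
    \forall y \near x, k y <= k x + inner d (y - x) + e * `|y - x|) ->
  (\forall y \near x, g x + (k x)%:E <= g y + (k y)%:E)%E ->
  subdiff g x (- d).
Proof.
move=> gN gC gx kd xmin.
have [a xa] : exists a : R, g x = a%:E.
  by move: gx (gN x); case: (g x) => // a; exists a.
split => [|y]; first by rewrite xa.
move: (gN y).
case yb: (g y) => [b||] // _; last by rewrite leey.
rewrite xa -EFinD lee_fin innerNl.
apply/ler_addgt0Pr => e e0; pose v := y - x.
have v1 : 0 < `|v| + 1 by rewrite ltr_wpDl.
have e'0 : 0 < e / (`|v| + 1) by rewrite divr_gt0.
have [r r0 rP] := near_radius2 (kd _ e'0) xmin.
have [t t0 [t1 tr]] := small_scale v1 r0.
have xtvE : x + t *: v - x = t *: v by rewrite addrC addKr.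
have xtv : `|x + t *: v - x| = t * `|v| by rewrite xtvE normrZ gtr0_norm.
have [] := rP (x + t *: v).
  by rewrite xtv (le_lt_trans _ tr)// ler_pM2l// lerDl.
rewrite xtv xtvE innerZr => h1.
have := gC y x t; rewrite ltW//= t1 => /(_ isT).
have -> : t *: y + (1 - t) *: x = x + t *: v.
  by rewrite /v scalerBr scalerBl scale1r addrC -addrA (addrC (- _)).
rewrite yb xa; move: (gN (x + t *: v)).
case: (g _) => [c _|//|//]; rewrite -!EFinM -!EFinD !lee_fin => h2 h3.
have h4 : 0 <= t * (b - a + inner d v + e / (`|v| + 1) * `|v|) by lra.
move: h4; rewrite pmulr_rge0// => h4.
have : e / (`|v| + 1) * `|v| <= e.
  by rewrite mulrAC ler_pdivrMr// ler_pM2l// lerDl.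
rewrite -/v; lra.
Qed.

(** The sum of [phi] and [- fine phi] vanishes near [x], so [x] is trivially a local minimiser and
    Fermat's rule yields the gradient as a subgradient. *)
Lemma convex_diff_subdiff phi (x d : X) : noNy phi -> convex_fun phi ->
  (\forall y \near x, phi y \is a fin_num) ->
  differentiable (fun y => fine (phi y)) x ->
  (forall v, 'd (fun y => fine (phi y)) x v = inner d v) ->
  subdiff phi x d.
Proof.
move=> pN pC pfin dphi dE; rewrite -[d]opprK.
have xfin : phi x \is a fin_num by exact: nbhs_singleton pfin.
apply: (@convex_local_min_subdiff _ (fun y => - fine (phi y))) => //.
- by rewrite ltey_eq xfin.
- move=> e e0; apply: filterS (diff_approx dphi e0) => y.
  rewrite dE ler_norml innerNl => /andP[h _]; lra.
apply: filterS pfin => y yfin.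
by rewrite -(fineK xfin) -(fineK yfin) -!EFinD lee_fin !subrr.
Qed.

Lemma convex_sum_sublevel (phi1 phi2 : X -> \bar R) (x y : X) (c t : R) :
  noNy phi1 -> noNy phi2 -> convex_fun phi1 -> convex_fun phi2 ->
  0 <= t <= 1 -> (phi1 x + phi2 x <= c%:E)%E -> (phi1 y + phi2 y <= c%:E)%E ->
  (phi1 (t *: x + (1 - t) *: y)%R + phi2 (t *: x + (1 - t) *: y)%R <= c%:E)%E.
Proof.
move=> N1 N2 C1 C2 t01.
have := C1 x y t t01; have := C2 x y t t01.
move: (N1 x) (N1 y) (N2 x) (N2 y).
case: (phi1 x) => [a||] //; case: (phi1 y) => [b||] //;
  case: (phi2 x) => [a'||] //; case: (phi2 y) => [b'||] // _ _ _ _.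
move=> h2 h1; rewrite -!EFinD !lee_fin => ha hb.
apply: le_trans (leeD h1 h2) _; rewrite -!EFinM -!EFinD lee_fin.
move: t01 => /andP[t0 t1].
have := ler_wpM2l t0 ha; have : (1 - t) * (b + b') <= (1 - t) * c.
  by rewrite ler_wpM2l// subr_ge0.
lra.
Qed.

End Subdifferential.

Section Conjugate.
Context {R : realType} {X : euclidType R}.
Implicit Types (g : X -> \bar R) (x y z : X).

Lemma fenchel_young g x z : ((inner z x)%:E - g x <= conjugate g z)%E.
Proof. by apply: ereal_sup_ubound; exists x. Qed.

Lemma conjugate_subdiff g x z (a : R) : subdiff g x z -> g x = a%:E ->
  conjugate g z = (inner z x - a)%:E.
Proof.
move=> zx xa; apply/le_anti/andP; split; last first.
  by have := fenchel_young g x z; rewrite xa.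
apply: ge_ereal_sup => _ [y _ <-].
case yb: (g y) => [b||].
- have := subdiffP zx xa yb; rewrite -EFinB lee_fin innerBr; lra.
- by rewrite leNye.
- by have := zx.2 y; rewrite yb xa -EFinD leNgt ltNyr.
Qed.

Lemma subdiff_conjugate g x z : subdiff g x z -> subdiff (conjugate g) z x.
Proof.
move=> zx; have [a xa] := subdiff_fin zx.
split; rewrite (conjugate_subdiff zx xa)// => z'.
apply: le_trans (fenchel_young g x z').
rewrite xa -EFinD lee_fin innerBr !(innerC x); lra.
Qed.

Lemma conjugate_noNy g x z : subdiff g x z -> noNy (conjugate g).
Proof.
move=> zx z'; have [a xa] := subdiff_fin zx.
rewrite -ltNye (lt_le_trans _ (fenchel_young g x z'))//.
by rewrite xa ltNyr.
Qed.

(* Minty's trick: a minimiser [y] of [g - <z,.> + |. - x|^2/2] satisfies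
   [z + x - y] in [subdiff g y], and monotonicity of the subdifferential of
   the conjugate forces [y = x]. *)
Lemma conjugate_subdiff_inv g x x0 z :
  noNy g -> closed_fun g -> convex_fun g -> subdiff g x0 z ->
  subdiff (conjugate g) z x -> subdiff g x z.
Proof.
move=> gN gcl gC zx0 xz.
have [a x0a] := subdiff_fin zx0.
pose k y := `|y - x| * `|y - x| / 2 - inner z y.
pose M := `|x0 - x| + 1.
pose A := [set y : X | `|y - x| <= M].
have cA : compact A.
  apply: (@closed_bounded_compact _ _ _ (M + `|x|)) => [|y yA]; last first.
    by rewrite -[y](subrK x) (le_trans (ler_normD _ _))// lerD2r.
  rewrite (_ : A = closed_ball_ Num.norm x M); last first.
    by apply/seteqP; split => y; rewrite /A/= distrC.
  exact: closed_closed_ball_.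
have kc y : {for y, continuous k}.
  apply: continuousB.
    apply: continuousM; last exact: cst_continuous.
    have nc : {for y, continuous (fun y => `|y - x|)}.
      apply: (@continuous_comp _ _ _ (fun y => y - x) Num.norm).
        by apply: continuousB; [exact: cvg_id|exact: cst_continuous].
      exact: norm_continuous.
    exact: continuousM.
  exact: (@finite_linear_continuous _ _ _ (finite_frame_euclid X)).
have Ax0 : A x0 by rewrite /A/= lerDl.
have [y yA ymin] := closed_fun_add_min gcl gN cA (ex_intro _ _ Ax0)
  (fun y _ => kc y).
have := ymin _ Ax0; rewrite x0a -EFinD => yx0.
have [b yb] : exists b : R, g y = b%:E.
  by move: yx0 (gN y); case: (g y) => // b; exists b.
move: yx0; rewrite yb -EFinD lee_fin /k -!expr2 => yx0.
have := subdiffP zx0 x0a yb; rewrite innerBr => yx1.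
have yx : `|y - x| < M.
  have : `|y - x| ^+ 2 <= `|x0 - x| ^+ 2 by lra.
  rewrite ler_sqr ?nnegrE// => /le_lt_trans; apply.
  by rewrite /M ltrDl.
have zy : subdiff g y (- (y - x - z)).
  apply: (@convex_local_min_subdiff _ _ _ k) => //; first by rewrite yb ltry.
    move=> e e0; apply: (radius_near e0) => w we.
    have -> : k w = k y + inner (y - x - z) (w - y) + `|w - y| ^+ 2 / 2.
      rewrite /k -!expr2 -!inner_norm !(innerBl, innerBr) (innerC w x) (innerC y x).
      by rewrite (innerC y w); field.
    rewrite lerD2l; have := normr_ge0 (w - y); nra.
  have My : 0 < M - `|y - x| by rewrite subr_gt0.
  apply: (radius_near My) => w wM; apply: ymin.
  rewrite /A/= -[w](subrK y) -addrA (le_trans (ler_normD _ _))//.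
  by rewrite -lerBrDr ltW.
have := subdiff_monotone (subdiff_conjugate zy) xz.
have -> : - (y - x - z) - z = - (y - x) by rewrite opprB [z - _]addrC addrK.
rewrite innerNl inner_norm oppr_ge0 => h.
have /eqP : `|y - x| ^+ 2 = 0 by apply/le_anti; rewrite h sqr_ge0.
rewrite sqrf_eq0 normr_eq0 subr_eq0 => /eqP yxE.
by move: zy; rewrite yxE subrr sub0r opprK.
Qed.

End Conjugate.

(** * The parallel subspace of a convex set *)

Section Parallel.
Context {R : realType} {X : euclidType R}.

Definition convex_combination_closed (Omega : set X) := forall (a b : X) (t : R), 0 <= t <= 1 ->
  Omega a -> Omega b -> Omega (t *: a + (1 - t) *: b).

Definition scaled_diff (Omega : set X) : set X :=
  [set w | exists2 c : R, 0 <= c & exists a b, [/\ Omega a, Omega b &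
     w = c *: (a - b)]].

Lemma scaled_diffN Omega w : scaled_diff Omega w -> scaled_diff Omega (- w).
Proof.
move=> [c c0 [a [b [Oa Ob ->]]]]; exists c => //; exists b, a; split => //.
by rewrite -scalerN opprB.
Qed.

Lemma scaled_diffZ Omega (s : R) w :
  scaled_diff Omega w -> scaled_diff Omega (s *: w).
Proof.
have pos (r : R) v : 0 <= r -> scaled_diff Omega v ->
    scaled_diff Omega (r *: v).
  move=> r0 [c c0 [a [b [Oa Ob ->]]]]; exists (r * c); first exact: mulr_ge0.
  by exists a, b; rewrite scalerA.
move=> Dw; have [s0|/ltW s0] := leP 0 s; first exact: pos.
rewrite -[s]opprK scaleNr; apply: scaled_diffN; apply: pos => //.
by rewrite oppr_ge0.
Qed.

(** For convex [Omega] scaled single differences already form the span: [c (a - b) + d (a' - b')] is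
    [c + d] times the difference of the convex combinations with weights [c / (c + d)] and
    [d / (c + d)]. *)
Lemma scaled_diffD Omega u v : convex_combination_closed Omega ->
  scaled_diff Omega u -> scaled_diff Omega v -> scaled_diff Omega (u + v).
Proof.
move=> OC [c c0 [a [b [Oa Ob ->]]]] [d d0 [a' [b' [Oa' Ob' ->]]]].
have [cd|cd] := eqVneq (c + d) 0.
  have [-> ->] : c = 0 /\ d = 0 by split; lra.
  by rewrite !scale0r addr0; exists 0 => //; exists a, b; rewrite scale0r.
have cd0 : 0 < c + d by rewrite lt_def cd addr_ge0.
pose t := c / (c + d).
have t01 : 0 <= t <= 1.
  by rewrite divr_ge0 ?(ltW cd0)//= ler_pdivrMr// mul1r lerDl.
exists (c + d); first exact: ltW.
exists (t *: a + (1 - t) *: a'), (t *: b + (1 - t) *: b').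
split; [exact: OC|exact: OC|].
have tc : (c + d) * t = c by rewrite mulrC divfK.
have td : (c + d) * (1 - t) = d by rewrite mulrBr tc mulr1 addrC addKr.
apply: inner_eq => w; rewrite !(innerDl, innerNl, innerZl).
transitivity ((c + d) * t * (inner a w - inner b w)
  + (c + d) * (1 - t) * (inner a' w - inner b' w)); last by ring.
by rewrite tc td.
Qed.

Lemma par_scaled_diff (Omega : set X) : convex_combination_closed Omega ->
  par Omega = scaled_diff Omega.
Proof.
move=> OC; apply/seteqP; split => w.
  move=> [x Ox [e eO we]].
  have D0 : scaled_diff Omega 0.
    by exists 0 => //; exists x, x; rewrite scale0r.
  rewrite [w](@coord_span _ _ _ (in_tuple e) _ we).
  apply: (big_ind (scaled_diff Omega)) => //.
    by move=> u v; exact: scaled_diffD.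
  move=> i _; apply: scaled_diffZ; exists 1 => //.
  exists (e`_i + x), x; split => //; first exact/eO/mem_nth.
  by rewrite addrK scale1r.
move=> [c _ [a [b [Oa Ob ->]]]]; exists b => //.
exists [:: a - b] => [u|]; first by rewrite inE => /eqP ->; rewrite subrK.
by rewrite memvZ// memv_span// inE.
Qed.

End Parallel.

(** * Cone reducible functions *)

Section LinearSubsets.
Context {R : realType} {W : euclidType R}.
Implicit Types (T C : set W).

Definition linear_subset T := T 0 /\ forall (a : R) u v, T u -> T v ->
  T (a *: u + v).

(** A subspace of maximal dimension inside [T] exhausts it, since adjoining a line of [T] cannot
    raise the dimension. *)
Lemma linear_subset_vspace T : linear_subset T ->
  exists S : {vspace W}, forall w, T w <-> w \in S.
Proof.
move=> [T0 TP].
pose Q n := `[< exists S : {vspace W}, \dim S = n /\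
  forall w, w \in S -> T w >].
have Q0 : exists n, Q n.
  exists 0%N; apply/asboolP; exists 0%VS; rewrite dimv0; split => // w.
  by rewrite memv0 => /eqP ->.
have Qle n : Q n -> (n <= \dim {:W})%N.
  by move=> /asboolP[S [<- _]]; exact/dimvS/subvf.
have [n /asboolP[S [Sn ST]] nmax] := ex_maxnP Q0 Qle.
exists S => w; split; last exact: ST.
move=> Tw; pose S' := (S + <[w]>)%VS.
have SS' : (S <= S')%VS by exact: addvSl.
have S'T v : v \in S' -> T v.
  move=> /memv_addP[u uS [_ /vlineP[k ->] ->]].
  by rewrite addrC; apply: TP => //; exact: ST.
have : Q (\dim S') by apply/asboolP; exists S'.
move=> /nmax; rewrite -Sn => dS.
have : S == S' by rewrite eqEdim SS'.
by move=> /eqP ->; exact/(subvP (addvSr _ _))/memv_line.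
Qed.

Definition polar C : set W := [set l | forall w, C w -> inner l w <= 0].

(** Moreau decomposition, with [c] the point of [C] nearest to [w]. Moving from [c] along a
    direction of [C] gives the polar condition, and moving along [c] and [- c] gives
    orthogonality. *)
Lemma cone_projection C (w : W) : closed C -> C 0 ->
  (forall u v, C u -> C v -> C (u + v)) ->
  (forall (a : R) v, 0 <= a -> C v -> C (a *: v)) ->
  exists2 c, C c & polar C (w - c) /\ inner (w - c) c = 0.
Proof.
move=> cC C0 CD CZ.
(* Points of norm above [2 |w|] are farther from [w] than [0] is, so a bounded piece of [C]
   suffices. *)
pose M := 2 * `|w| + 1.
pose A := C `&` [set d : W | `|d| <= M].
have cA : compact A.
  apply: (@closed_bounded_compact _ _ _ M) => [|y []//].
  apply: closedI => //.
  apply: (@closed_comp _ _ (fun d : W => `|d|) [set x : R | x <= M]); last exact: closed_le.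
  by move=> ? _; exact: norm_continuous.
have A0 : A 0 by split => //=; rewrite normr0 addr_ge0// mulr_ge0.
have [c /set_mem[Cc cM] cmin] : exists2 c, c \in A &
    forall t, t \in A -> `|w - c| <= `|w - t|.
  apply: (@compact_EVT_min _ _ (fun t => `|w - t|)) => //; first by exists 0.
  apply: continuous_subspaceT => y.
  apply: (@continuous_comp _ _ _ (fun y => w - y) Num.norm).
    by apply: continuousB; [exact: cst_continuous|exact: cvg_id].
  exact: norm_continuous.
have {}cmin d : C d -> `|w - c| <= `|w - d|.
  move=> Cd; have [dM|dM] := leP `|d| M; first by apply: cmin; rewrite inE.
  have := cmin 0; rewrite inE subr0 => /(_ A0)/le_trans; apply.
  have := lerB_normD d (- w); rewrite normrN -(distrC d w).
  by rewrite /M in dM; move: (normr_ge0 w); lra.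
have key (v : W) : (exists2 t0 : R, 0 < t0 &
    forall t : R, 0 <= t <= t0 -> C (c + t *: v)) -> inner (w - c) v <= 0.
  move=> [t0 t00 Cv]; rewrite leNgt; apply/negP => h0.
  set h := inner (w - c) v in h0.
  pose t := Num.min t0 (h / (`|v| ^+ 2 + 1)).
  have v1 : 0 < `|v| ^+ 2 + 1 by rewrite ltr_wpDl// sqr_ge0.
  have tpos : 0 < t by rewrite lt_min t00 divr_gt0.
  have tt0 : 0 <= t <= t0 by rewrite ltW//= ge_min lexx.
  have th : t * (`|v| ^+ 2 + 1) <= h.
    by rewrite -ler_pdivlMr// ge_min lexx orbT.
  have := cmin _ (Cv t tt0).
  rewrite -ler_sqr ?nnegrE// opprD addrA (sqr_normB (w - c)) innerZr -/h.
  rewrite normrZ gtr0_norm// exprMn => H.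
  have : t * (2 * h) <= t * (t * `|v| ^+ 2) by lra.
  by rewrite ler_pM2l//; lra.
exists c => //; split.
  move=> d Cd; apply: key; exists 1 => // t /andP[t0 _].
  by apply: CD => //; exact: CZ.
apply/le_anti/andP; split.
  by apply: key; exists 1 => // t /andP[t0 _]; apply: CD => //; exact: CZ.
rewrite -oppr_le0 -innerNr; apply: key; exists 1 => // t /andP[t0 t1].
rewrite scalerN -[X in X - _]scale1r -scalerBl; apply: CZ => //.
by rewrite subr_ge0.
Qed.

(** This says that the polar of a pointed cone spans. The Moreau decomposition puts any vector
    orthogonal to the polar into [C]; the same holds for its opposite, and pointedness leaves only
    [0]. *)
Lemma polar_orthogonal C (w : W) : closed_convex_pointed_cone C ->
  (forall l, polar C l -> inner l w = 0) -> w = 0.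
Proof.
move=> [cC Cconv CZ Cpt] wC.
have C0 : C 0.
  have : [set 0 : W] 0 by [].
  by rewrite -Cpt => -[].
have CD u v : C u -> C v -> C (u + v).
  move=> Cu Cv.
  have h0 : (0 : R) <= 2^-1 by lra.
  have h1 : (2^-1 : R) <= 1 by lra.
  have := Cconv u v (Itv01 h0 h1).
  rewrite !inE => /(_ Cu Cv) /(CZ 2 _ (ler0n _ 2)).
  rewrite /conv/= /unstable.onem scalerDr !scalerA.
  have -> : 1 - 2^-1 = 2^-1 :> R by lra.
  by rewrite divff// !scale1r.
have wE v : (forall l, polar C l -> inner l v = 0) -> C v.
  move=> vC; have [c Cc [pc c0]] := cone_projection v cC C0 CD CZ.
  have : inner (v - c) (v - c) = 0 by rewrite innerBr c0 (vC _ pc) subr0.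
  by rewrite inner_norm => /eqP; rewrite sqrf_eq0 normr_eq0 subr_eq0 => /eqP ->.
have : (C `&` (-%R @` C)) w.
  split; first exact: wE.
  exists (- w); last by rewrite opprK.
  by apply: wE => l /wC; rewrite innerNr => ->; rewrite oppr0.
by rewrite Cpt.
Qed.

(** For a subspace the Moreau decomposition is the orthogonal one; closedness holds because [T] is
    the kernel of [1 - projv S]. *)
Lemma linear_subset_full T : linear_subset T ->
  (forall w, (forall t, T t -> inner t w = 0) -> w = 0) -> forall w, T w.
Proof.
move=> TL Tperp w; have [S TS] := linear_subset_vspace TL.
have [T0 TP] := TL.
pose f : {linear W -> W} := (\1 - projv S)%VF.
have TE : T = f @^-1` [set 0].
  apply/seteqP; split => v; rewrite /preimage/= add_lfunE opp_lfunE id_lfunE.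
    by move=> /TS/projv_id ->; rewrite subrr.
  by move=> /subr0_eq ->; apply/TS; exact: memv_proj.
have cT : closed T.
  rewrite TE; apply: preimage_closed => [x _|].
    exact: (@finite_linear_continuous _ _ _ (finite_frame_euclid W)).
  exact: accessible_closed_set1 (hausdorff_accessible (@norm_hausdorff _ _)) _.
have TZ (a : R) v : T v -> T (a *: v).
  by move=> Tv; rewrite -[a *: v]addr0; exact: TP.
have TD u v : T u -> T v -> T (u + v).
  by move=> Tu Tv; rewrite -[u]scale1r; exact: TP.
have [c Tc [pc _]] := cone_projection w cT T0 TD (fun a v _ => @TZ a v).
suff /subr0_eq -> : w - c = 0 by [].
apply: Tperp => t Tt; rewrite innerC; apply/le_anti; rewrite pc//=.
by rewrite -oppr_le0 -innerNr pc// -scaleN1r; exact: TZ.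
Qed.

End LinearSubsets.

(** * Local surjectivity and Lagrange multipliers *)

Section Lyusternik.
Context {R : realType} {V : normedModType R} {W : euclidType R}.
Variables (h : V -> W) (D : {linear V -> W}) (A : {linear W -> V}).
Variables (a : V) (e K r : R).
Hypotheses (DA : forall w, D (A w) = w) (K_gt0 : 0 < K)
  (AK : forall w, `|A w| <= K * `|w|) (eK : e * K <= 2^-1)
  (e_ge0 : 0 <= e)
  (strict : forall x y, `|x - a| < r -> `|y - a| < r ->
     `|h y - h x - D (y - x)| <= e * `|y - x|).

(* A minimiser of [|h (q + A xi) - w|] over a ball is a zero: otherwise the
   Newton step [xi - (h (q + A xi) - w)] would at least halve the residual. *)
Lemma local_surjection (q : V) (w : W) :
  `|q - a| + K * (5 * `|h q - w|) < r ->
  exists2 xi : W, h (q + A xi) = w & `|xi| <= 2 * `|h q - w|.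
Proof.
set m := `|h q - w| => qr.
(* The minimiser turns out to have norm at most [4 m], and the Newton step adds at most [m]; radius
   [5 m] keeps the new point admissible. *)
pose B : set W := [set xi | `|xi| <= 5 * m].
have m0 : 0 <= m by exact: normr_ge0.
have inr xi : B xi -> `|q + A xi - a| < r.
  move=> Bxi; rewrite addrAC (le_lt_trans (ler_normD _ _))//.
  by rewrite (le_lt_trans _ qr)// lerD2l (le_trans (AK _))// ler_pM2l.
have est xi xi' : B xi -> B xi' ->
    `|h (q + A xi') - h (q + A xi) - (xi' - xi)| <= 2^-1 * `|xi' - xi|.
  move=> Bxi Bxi'; have := strict (inr _ Bxi) (inr _ Bxi').
  rewrite [q + A xi']addrC addrKA -linearB DA => /le_trans; apply.
  apply: le_trans (ler_wpM2l e_ge0 (AK _)) _.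
  by rewrite mulrA ler_wpM2r.
have B0 : B 0 by rewrite /B/= normr0 mulr_ge0.
have cB : compact B.
  apply: (@closed_bounded_compact _ _ _ (5 * m)) => //.
  apply: (@closed_comp _ _ (fun d : W => `|d|) [set x : R | x <= 5 * m]).
    by move=> ? _; exact: norm_continuous.
  exact: closed_le.
have [xi Bxi ximin] : exists2 xi, B xi & forall y, B y ->
    (`|h (q + A xi) - w|%:E <= `|h (q + A y) - w|%:E)%E.
  apply: (compact_lsc_min (psi := fun xi => `|h (q + A xi) - w|%:E)) => //.
    by exists 0.
  move=> x c Bx; rewrite lte_fin -subr_gt0 => xc.
  apply: (radius_near (r := (`|h (q + A x) - w| - c) / 2)).
    by rewrite divr_gt0.
  move=> y yx By; rewrite lte_fin.
  have := est _ _ By Bx.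
  have := ler_normD (h (q + A x) - h (q + A y) - (x - y)) (x - y).
  rewrite subrK.
  have := ler_distD (h (q + A y)) (h (q + A x)) w.
  by move: yx; rewrite (distrC x y); lra.
pose eta := h (q + A xi) - w.
have hm : `|eta| <= m.
  by have := ximin _ B0; rewrite lee_fin linear0 addr0.
have xim : `|xi| <= 2 * `|h (q + A xi) - h q|.
  have := est _ _ B0 Bxi; rewrite linear0 addr0 subr0.
  have := ler_normD (h (q + A xi) - h q) (- (h (q + A xi) - h q - xi)).
  rewrite normrN opprB addrCA subrr addr0; lra.
have xi4 : `|xi| <= 4 * m.
  have := ler_normB (h (q + A xi) - w) (h q - w).
  rewrite opprB addrA subrK -/eta -/m; lra.
have eta0 : eta = 0.
  have Bxi' : B (xi - eta) by rewrite /B/=; have := ler_normB xi eta; lra.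
  have := est _ _ Bxi Bxi'; have := ximin _ Bxi'; rewrite lee_fin -/eta.
  rewrite [xi - eta - xi]addrC addrA addNr add0r opprK normrN.
  have -> : h (q + A (xi - eta)) - h (q + A xi) + eta
      = h (q + A (xi - eta)) - w by rewrite /eta addrA subrK.
  move=> h1 h2; apply/eqP; rewrite -normr_le0; lra.
have hw : h (q + A xi) = w by exact: subr0_eq.
by exists xi => //; move: xim; rewrite hw distrC.
Qed.

(* Lagrange multipliers for a functional that is nonpositive on the directions
   from [v] into [h @^-1` C]. *)
Lemma normal_multiplier (U : set V) (C : set W) (n : {linear V -> R^o})
    (Kn : R) (v : V) :
  (forall q, `|n q| <= Kn * `|q|) -> open_nbhs v U -> `|v - a| < r ->
  differentiable h v -> C (h v) ->
  (forall q, U q -> C (h q) -> n (q - v) <= 0) ->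
  (forall q, `|'d h v q - D q| <= e * `|q|) ->
  exists l : W, forall q, n q = inner l ('d h v q).
Proof.
move=> nK vU va dh Chv nC dhD; have K0 := ltW K_gt0.
have Kn0 : 0 <= `|Kn| := normr_ge0 _.
have {}nK q : `|n q| <= `|Kn| * `|q|.
  by rewrite (le_trans (nK q))// ler_wpM2r// ler_norm.
(* Along a kernel direction [h] changes by [o(t)], so a correction of size [o(t)] brings [v + t q]
   back to the level [h v], which lies in [C]; the sign of [n] there survives as [t] tends to
   [0]. *)
have ker_le0 q : 'd h v q = 0 -> n q <= 0.
  move=> dq0; apply/ler_addgt0Pr => eps eps0; rewrite add0r.
  pose c := 2 * `|Kn| * K * `|q| + 1.
  have c0 : 0 < c by rewrite ltr_wpDl// !mulr_ge0//.
  have e1_gt0 : 0 < eps / c by rewrite divr_gt0.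
  set e1 := eps / c in e1_gt0; have e1_ge0 := ltW e1_gt0.
  have [r1 r1_gt0 rP] := near_radius2 (diff_approx dh e1_gt0) (open_nbhs_near vU).
  (* [t b] dominates the displacement [t |q|] plus the correction [5 K e1 t |q|], so one bound on
     [t] serves the expansion of [h], membership in [U] and [local_surjection]. *)
  pose b := `|q| * (1 + 5 * K * e1) + 1.
  have Ke : 0 <= 5 * K * e1 by rewrite mulr_ge0// mulr_ge0.
  have b0 : 0 < b by rewrite ltr_wpDl// mulr_ge0// addr_ge0.
  pose s := Num.min r1 (r - `|v - a|).
  have s0 : 0 < s by rewrite lt_min r1_gt0 subr_gt0.
  have [t t0 [_ tb]] := small_scale b0 s0.
  have {tb}[tb1 tb2] : t * b < r1 /\ t * b < r - `|v - a|.
    by apply/andP; rewrite -lt_min.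
  pose y := v + t *: q.
  have yv : y - v = t *: q by rewrite /y addrC addKr.
  have ytq : `|y - v| = t * `|q| by rewrite yv normrZ gtr0_norm.
  have tq0 : 0 <= t * `|q| by rewrite mulr_ge0 ?(ltW t0).
  have tqb : t * b = t * `|q| + 5 * K * e1 * (t * `|q|) + t.
    by rewrite /b; ring.
  have Ketq : 0 <= 5 * K * e1 * (t * `|q|) by rewrite mulr_ge0.
  have hy : `|h y - h v| <= e1 * (t * `|q|).
    have dyv : 'd h v (y - v) = 0.
      by rewrite yv (linearZ_LR ('d h v)) dq0 /GRing.scale/= scaler0.
    have [|+ _] := rP y; first by rewrite ytq; lra.
    by rewrite dyv subr0 ytq.
  have [|xi hxi xile] := @local_surjection y (h v).
    have ya : `|y - a| <= `|v - a| + t * `|q|.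
      by have := ler_distD v y a; rewrite ytq; lra.
    have : K * (5 * `|h y - h v|) <= K * (5 * (e1 * (t * `|q|))).
      by rewrite ler_pM2l// ler_pM2l.
    lra.
  have Axi : `|A xi| <= K * (2 * (e1 * (t * `|q|))).
    by rewrite (le_trans (AK _))// ler_pM2l// (le_trans xile)// ler_pM2l.
  have zv : y + A xi - v = t *: q + A xi by rewrite addrAC yv.
  have Uz : U (y + A xi).
    apply: (rP _ _).2; rewrite zv (le_lt_trans (ler_normD _ _))//.
    rewrite normrZ gtr0_norm//.
    lra.
  have := nC _ Uz; rewrite hxi => /(_ Chv).
  rewrite zv linearD (linearZ_LR n).
  have := nK (A xi); rewrite ler_norml => /andP[h1 _] h2.
  have h3 : `|Kn| * `|A xi| <= `|Kn| * (K * (2 * (e1 * (t * `|q|)))).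
    by rewrite ler_wpM2l.
  have h4 : t * n q <= t * (e1 * (2 * `|Kn| * K * `|q|)).
    move: h2; rewrite -[t *: n q]/(t * n q); lra.
  move: h4; rewrite ler_pM2l// => /le_trans; apply.
  by rewrite /e1 mulrAC ler_pdivrMr// ler_pM2l// /c lerDl.
have ker0 q : 'd h v q = 0 -> n q = 0.
  move=> dq0; apply/le_anti; rewrite ker_le0//=.
  rewrite -oppr_le0 -linearN ker_le0//.
  by rewrite (linearN ('d h v)) dq0 oppr0.
(* Since [e K <= 1/2], the map ['d h v \o A] is close enough to the identity to be invertible. As
   [n] vanishes on the kernel of ['d h v], it factors through ['d h v] by [n \o A \o E^-1], whose
   Riesz vector is the multiplier. *)
have Elin : linear (fun w => 'd h v (A w)) by move=> k x y; rewrite !linearP.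
pose E' : {linear W -> W} := HB.pack (fun w => 'd h v (A w))
  (GRing.isLinear.Build R W W _ _ Elin).
pose E := linfun E'.
have EE w : E w = 'd h v (A w) by rewrite lfunE.
have E0 : lker E == 0%VS.
  apply/lker0P => x y xy.
  have Exy : 'd h v (A (x - y)) = 0 by rewrite (linearB A) (linearB ('d h v)) -!EE xy subrr.
  apply/eqP; rewrite -subr_eq0 -normr_le0.
  have := dhD (A (x - y)); rewrite Exy DA sub0r normrN.
  have := ler_wpM2l e_ge0 (AK (x - y)); rewrite mulrA.
  have := ler_wpM2r (normr_ge0 (x - y)) eK; lra.
have llin : linear (fun w => n (A ((E^-1)%VF w)) : R).
  by move=> k x y; rewrite !linearP.
pose l' : {linear W -> R} := HB.pack (fun w => n (A ((E^-1)%VF w)) : R)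
  (GRing.isLinear.Build R W R _ _ llin).
have [l lE] := riesz l'.
exists l => q; rewrite -lE /=.
apply/eqP; rewrite -subr_eq0 -linearB; apply/eqP/ker0.
by rewrite linearB -EE lker0_lfunVK// subrr.
Qed.

(** Testing the multiplier identity at [A l] gives [|l|^2] up to an error of at most half of it. *)
Lemma multiplier_bound (n : {linear V -> R^o}) (Kn : R) (v : V) (l : W) :
  0 <= Kn -> (forall q, `|n q| <= Kn * `|q|) ->
  (forall q, `|'d h v q - D q| <= e * `|q|) ->
  (forall q, n q = inner l ('d h v q)) ->
  `|l| <= 2 * K * Kn.
Proof.
move=> Kn0 nK dhD nE.
have K0 := ltW K_gt0; have [->|l0] := eqVneq l 0; first by rewrite normr0 !mulr_ge0//.
have lpos : 0 < `|l| by rewrite normr_gt0.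
have H : `|l| ^+ 2 = n (A l) - inner l ('d h v (A l) - D (A l)).
  by rewrite nE innerBr DA inner_norm; lra.
have h1 : n (A l) <= Kn * (K * `|l|).
  rewrite (le_trans (ler_norm _))// (le_trans (nK _))//.
  by rewrite ler_wpM2l.
have h2 : - inner l ('d h v (A l) - D (A l)) <= `|l| * (2^-1 * `|l|).
  rewrite -innerNr (le_trans (ler_inner _ _))// normrN ler_wpM2l//.
  rewrite (le_trans (dhD _))// (le_trans (ler_wpM2l e_ge0 (AK _)))//.
  by rewrite mulrA ler_wpM2r.
have : `|l| * `|l| <= `|l| * (2 * K * Kn) by lra.
by rewrite ler_pM2l.
Qed.

End Lyusternik.

Lemma linear_right_inverse (R : realType) (V : normedModType R)
    (W : euclidType R) (D : {linear V -> W}) :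
  (forall w, exists v, D v = w) ->
  exists A : {linear W -> V}, forall w, D (A w) = w.
Proof.
move=> Dsurj; have [n [b [d bd]]] := dual_basis W.
have /choice[c cE] (i : 'I_n) : exists v, D v = b i by exact: Dsurj.
have Alin : linear (fun w => \sum_i inner (d i) w *: c i).
  move=> k u w; rewrite scaler_sumr -big_split/=; apply: eq_bigr => i _.
  by rewrite innerDr innerZr scalerDl scalerA.
pose A : {linear W -> V} := HB.pack (fun w => \sum_i inner (d i) w *: c i)
  (GRing.isLinear.Build R W V _ _ Alin).
exists A => w; rewrite [RHS]bd /= linear_sum; apply: eq_bigr => i _.
by rewrite linearZ_LR cE.
Qed.

(** * Multipliers at the base point and the parallel subspace *)

Section ReducibleRange.
Context {R : realType} {X : euclidType R}.
Implicit Types (psi : X -> \bar R).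

Lemma pair_lin (u : X) (s t : R) (v : X) (k : R) :
  k *: (u, s) + (v, t) = (k *: u + v, k * s + t) :> X * R.
Proof. by []. Qed.

Lemma epi_conjugate_convex (g : X -> \bar R) (p q : X * R) (t : R) :
  noNy g -> 0 <= t <= 1 -> epi (conjugate g) p -> epi (conjugate g) q ->
  epi (conjugate g) (t *: p + (1 - t) *: q).
Proof.
move: p q => [u s] [v s'] gN /andP[t0 t1] up vq.
apply: ge_ereal_sup => _ [x _ <-] /=.
move: (gN x); case xa: (g x) => [a||] // _; last by rewrite leNye.
have := le_trans (fenchel_young g x u) up.
have := le_trans (fenchel_young g x v) vq.
rewrite xa -!EFinB !lee_fin /= innerDl !innerZl => h1 h2.
have h3 : (1 - t) * (inner v x - a) <= (1 - t) * s'.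
  by rewrite ler_wpM2l// subr_ge0.
have h4 : t * (inner u x - a) <= t * s by rewrite ler_wpM2l.
rewrite -![_ *: _]/(_ * _); lra.
Qed.

Lemma functional_pair (W : euclidType R) (D : {linear (X * R)%type -> W})
    (eta : W) : exists (y : X) (beta : R),
  forall a s, inner eta (D (a, s)) = inner y a + beta * s.
Proof.
have lin : linear (fun a => inner eta (D (a, 0)) : R).
  move=> k u v; rewrite -[RHS]/(k * _ + _) -innerZr -innerDr -linearP.
  by rewrite pair_lin mulr0 addr0.
pose l : {linear X -> R} := HB.pack (fun a => inner eta (D (a, 0)) : R)
  (GRing.isLinear.Build R X R _ _ lin).
have [y yE] := riesz l.
exists y, (inner eta (D (0, 1))) => a s.
rewrite -yE /= mulrC -innerZr -innerDr addrC -linearP.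
by rewrite pair_lin scaler0 add0r mulr1 addr0.
Qed.

Variables (psi : X -> \bar R) (xbar zbar : X) (b : R).
Hypotheses (psiN : noNy psi) (psib : psi zbar = b%:E)
  (epiC : forall p q (t : R), 0 <= t <= 1 -> epi psi p -> epi psi q ->
     epi psi (t *: p + (1 - t) *: q))
  (xz : subdiff psi zbar xbar).
Variables (W : euclidType R) (C : set W) (h : X * R -> W) (U : set (X * R)).
Hypotheses (aU : open_nbhs (zbar, b) U) (dh : differentiable h (zbar, b))
  (hC : epi psi `&` U = [set v | U v /\ C (h v)]) (h0 : h (zbar, b) = 0).

(** By convexity the start of the segment from the base point to [q] stays in the epigraph. There
    [h] takes values in [C] and, vanishing at the base point, equals [t] times its derivative up to
    [o(t)]. *)
Lemma polar_normal_epi (eta : W) (q : X * R) : polar C eta -> epi psi q ->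
  inner eta ('d h (zbar, b) (q - (zbar, b))) <= 0.
Proof.
move=> Ceta qe; set a := (zbar, b); set v := q - a.
have aU' : open_nbhs a U := aU; have dh' : differentiable h a := dh.
have h0' : h a = 0 := h0.
apply/ler_addgt0Pr => e e0; rewrite add0r.
pose c := `|eta| * `|v| + 1.
have c0 : 0 < c by rewrite ltr_wpDl// mulr_ge0.
have ec : 0 < e / c by rewrite divr_gt0.
have [r r0 rP] := near_radius2 (diff_approx dh' ec) (open_nbhs_near aU').
have v1 : 0 < `|v| + 1 by rewrite ltr_wpDl.
have [t t0 [t1 tr]] := small_scale v1 r0.
have tv : `|t *: v| = t * `|v| by rewrite normrZ gtr0_norm.
have ta : a + t *: v - a = t *: v by rewrite addrC addKr.
have [|apx Uat] := rP (a + t *: v); first by rewrite ta tv; lra.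
have at_epi : epi psi (a + t *: v).
  have -> : a + t *: v = t *: q + (1 - t) *: a.
    by rewrite /v scalerBr scalerBl scale1r addrC -addrA (addrC (- _)).
  by apply: epiC => //; rewrite ?(ltW t0)//= /epi/= psib.
have : (epi psi `&` U) (a + t *: v) by [].
rewrite hC => -[_ /Ceta].
move: apx; rewrite ta tv h0' subr0 => apx het.
have := le_trans (norm_inner_le eta _) (ler_wpM2l (normr_ge0 eta) apx).
rewrite ler_norml innerBr (linearZ_LR ('d h a)) innerZr => /andP[h1 _].
have : t * inner eta ('d h a v) <= t * (e / c * (`|eta| * `|v|)) by lra.
rewrite ler_pM2l// => /le_trans; apply.
by rewrite mulrAC ler_pdivrMr// ler_pM2l// lerDl.
Qed.

(** Adding [beta (xbar, -1)] makes the pulled-back functional [(y, beta)] horizontal. The claim is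
    linear in [eta] and the polar of [C] spans, so it suffices to treat polar [eta], for which
    [(y, beta)] is normal to the epigraph: if [beta < 0] then [- y / beta] is a subgradient, and if
    [beta = 0] then [xbar + y] is one. *)
Lemma reducible_range (eta : W) (y : X) (beta : R) :
  closed_convex_pointed_cone C ->
  (forall a s, inner eta ('d h (zbar, b) (a, s)) = inner y a + beta * s) ->
  scaled_diff (subdiff psi zbar) (y + beta *: xbar).
Proof.
move=> Ccone; set D := 'd h (zbar, b).
have xin z s : psi z = s%:E -> b + inner xbar (z - zbar) <= s.
  by move=> zs; have := subdiffP xz psib zs.
(* The pair [(y, beta)] exists for every [eta] by [functional_pair] and is unique by [eqF], so the
   universal quantifier only names it. *)
pose T (eta : W) := forall (y : X) (beta : R),
  (forall a s, inner eta (D (a, s)) = inner y a + beta * s) ->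
  scaled_diff (subdiff psi zbar) (y + beta *: xbar).
have subF u v : subdiff psi zbar u -> subdiff psi zbar v ->
    scaled_diff (subdiff psi zbar) (u - v).
  by move=> Fu Fv; exists 1 => //; exists u, v; rewrite scale1r.
have D0 : scaled_diff (subdiff psi zbar) 0 by rewrite -(subrr xbar); exact: subF.
have eqF (eta' : W) y1 b1 y2 b2 :
    (forall a s, inner eta' (D (a, s)) = inner y1 a + b1 * s) ->
    (forall a s, inner eta' (D (a, s)) = inner y2 a + b2 * s) ->
    y1 = y2 /\ b1 = b2.
  move=> E1 E2; split.
    by apply: inner_eq => a; have := E1 a 0; rewrite E2; lra.
  by have := E1 0 1; rewrite E2 !inner0r; lra.
have TL : linear_subset T.
  split=> [y1 b1 E|k u v Tu Tv y1 b1 E].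
    have [-> ->] : y1 = 0 /\ b1 = 0.
      by apply: eqF E _ => a s; rewrite !inner0l mul0r addr0.
    by rewrite scale0r addr0.
  have [yu [bu Eu]] := functional_pair D u.
  have [yv [bv Ev]] := functional_pair D v.
  have [-> ->] : y1 = k *: yu + yv /\ b1 = k * bu + bv.
    apply: eqF E _ => a s; rewrite innerDl innerZl Eu Ev innerDl innerZl; ring.
  have -> : k *: yu + yv + (k * bu + bv) *: xbar
      = k *: (yu + bu *: xbar) + (yv + bv *: xbar).
    by rewrite scalerDl scalerDr scalerA addrACA.
  apply: scaled_diffD; last exact: Tv.
    by move=> u' v' t t01; exact: subdiff_convex.
  exact/scaled_diffZ/Tu.
suff TW : forall w, T w by move=> E; exact: TW E.
apply: (linear_subset_full TL) => w Tw.
apply: (polar_orthogonal Ccone) => l lC; apply: Tw => {y beta eta} y beta E.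
have normal q : epi psi q -> inner y (q.1 - zbar) + beta * (q.2 - b) <= 0.
  by move=> /(polar_normal_epi lC); rewrite -E -[_ - _]/(_, _).
have zin z s : psi z = s%:E -> inner y (z - zbar) + beta * (s - b) <= 0.
  by move=> zs; apply: (normal (z, s)); rewrite /epi/= zs.
have beta_le0 : beta <= 0.
  have := normal (zbar, b + 1); rewrite /epi/= psib lee_fin lerDl ler01.
  by move=> /(_ isT); rewrite subrr inner0r; lra.
have Fin u : (forall z s, psi z = s%:E -> b + inner u (z - zbar) <= s) ->
    subdiff psi zbar u.
  move=> uin; split=> [|z]; first by rewrite psib.
  move: (psiN z); case zs: (psi z) => [s||] // _; last by rewrite leey.
  by rewrite psib -EFinD lee_fin; exact: uin.
have [b0|b0] := eqVneq beta 0.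
  rewrite b0 scale0r addr0 -[y](addrK xbar).
  apply: subF => //; apply: Fin => z s zs.
  by have := xin _ _ zs; have := zin _ _ zs; rewrite b0 innerDl; lra.
have bneg : 0 < - beta by rewrite oppr_gt0 lt_def eq_sym b0.
exists (- beta); first exact: ltW.
exists ((- beta)^-1 *: y), xbar; split => //; last first.
  by rewrite scalerBr scalerA divff ?gt_eqF// scale1r scaleNr opprK.
apply: Fin => z s zs; have := zin _ _ zs; rewrite innerZl => h1.
by rewrite -lerBrDl mulrC ler_pdivrMr//; lra.
Qed.

End ReducibleRange.

(** * The subdifferential of a reducible function modulo the parallel subspace *)

Section ReducibleEstimate.
Context {R : realType} {X : euclidType R}.

Lemma norm_fst (V W : normedModType R) (q : V * W) : `|q.1| <= `|q|.
Proof. by rewrite prod_normE le_max lexx. Qed.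

Lemma norm_snd (V W : normedModType R) (q : V * W) : `|q.2| <= `|q|.
Proof. by rewrite prod_normE le_max lexx orbT. Qed.

Lemma norm_pair_le (V W : normedModType R) (q : V * W) :
  `|q| <= `|q.1| + `|q.2|.
Proof. by rewrite prod_normE ge_max lerDl lerDr !normr_ge0. Qed.

Lemma subdiff_value_lipschitz (psi : X -> \bar R) (z z' x x' : X)
    (b b' B : R) : psi z = b%:E -> psi z' = b'%:E ->
  subdiff psi z x -> subdiff psi z' x' -> `|x| <= B -> `|x'| <= B ->
  `|b - b'| <= B * `|z - z'|.
Proof.
move=> zb zb' xz xz' xB xB'.
have := subdiffP xz zb zb'; have := subdiffP xz' zb' zb => h1 h2.
have := le_trans (norm_inner_le x (z - z')) (ler_wpM2r (normr_ge0 (z - z')) xB).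
have := le_trans (norm_inner_le x' (z - z')) (ler_wpM2r (normr_ge0 (z - z')) xB').
rewrite !ler_norml => /andP[h3 h4] /andP[h5 h6].
move: h2; rewrite -(opprB z z') innerNr => h2.
by apply/andP; split; lra.
Qed.

Lemma inner_increment (W : euclidType R) (l l' p p' d : W) :
  inner l p - inner l' p' - inner (l - l') d
  = inner (l - l') (p - d) + inner l' (p - p').
Proof. by rewrite !innerBl !innerBr; ring. Qed.

(** Here [eta = |l - l'|], [u = |x - x'|] and [s] is the error from the variation of ['d h]; the
    quadratic hypothesis is the multiplier identity tested at [A (l - l')]. Cancelling one [eta] and
    absorbing [e K eta <= eta / 2] gives the bound. *)
Lemma multiplier_increment_bound (K e eta u s : R) : 0 <= eta ->
  e * K <= 2^-1 -> eta * eta <= u * (K * eta) + (e * eta + s) * (K * eta) ->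
  0 <= K -> 0 <= u -> 0 <= s -> eta <= 2 * K * (u + s).
Proof.
move=> eta0 eK h K0 u0 s0; have [->|etan0] := eqVneq eta 0.
  by rewrite !mulr_ge0// addr_ge0.
have epos : 0 < eta by rewrite lt_def etan0.
have : eta * eta <= eta * (K * u + K * (e * eta + s)) by lra.
rewrite ler_pM2l//; have : e * K * eta <= 2^-1 * eta by rewrite ler_wpM2r.
lra.
Qed.

Lemma remainder_bound (K e eps eta u s B : R) : 0 <= e -> 0 <= K -> 0 <= B ->
  0 <= u -> 0 <= s -> e * K <= 2^-1 -> e * (2 * K * B) <= eps ->
  eta <= 2 * K * (u + s) -> (e * eta + s) * B <= eps * u + 2 * s * B.
Proof.
move=> e0 K0 B0 u0 s0 eK eeps heta.
have h1 : e * (2 * K * B) * u <= eps * u by rewrite ler_wpM2r.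
have h2 : e * K * s <= 2^-1 * s by rewrite ler_wpM2r.
have h3 : e * eta <= e * (2 * K * (u + s)) by rewrite ler_wpM2l.
have : (e * eta + s) * B <= (e * (2 * K) * u + 2 * s) * B.
  by rewrite ler_wpM2r//; lra.
lra.
Qed.

(* Modulo the parallel subspace of [subdiff psi zbar], the subdifferential of a
   reducible function behaves like a Lipschitz mapping, up to an arbitrarily
   small multiple of the increment itself. *)
Lemma reducible_subdiff_estimate (psi : X -> \bar R) (xbar zbar : X) :
  noNy psi ->
  (forall p q (t : R), 0 <= t <= 1 -> epi psi p -> epi psi q ->
     epi psi (t *: p + (1 - t) *: q)) ->
  subdiff psi zbar xbar -> C2_cone_reducible_fun psi zbar ->
  exists2 K : R, 0 <= K & forall eps : R, 0 < eps ->
    exists2 r : R, 0 < r & forall z z' x x',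
      `|z - zbar| < r -> `|z' - zbar| < r ->
      `|x - xbar| < 1 -> `|x' - xbar| < 1 ->
      subdiff psi z x -> subdiff psi z' x' ->
      exists2 y, scaled_diff (subdiff psi zbar) y &
        `|x - x' - y| <= eps * `|x - x'| + K * `|z - z'|.
Proof.
move=> psiN epiC xz [_ ].
have [b0 psib] := subdiff_fin xz; rewrite psib /=.
set a := (zbar, b0).
move=> [U [W [C [h [aU Ccone C2h [h0 Dsurj hC]]]]]].
have fV : finite_frame (X * R)%type.
  exact: finite_frame_prod (finite_frame_euclid X) finite_frame_real.
have Ua : U a by case: aU.
have dha : differentiable h a by case: C2h => + _; apply.
set D := 'd h a in Dsurj.
have [A DA] := linear_right_inverse Dsurj.
have [KA KA0 AK] := finite_linear_bounded (finite_frame_euclid W) A.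
have KA_ge0 := ltW KA0.
pose B := `|xbar| + 1.
have B1 : 1 <= B by rewrite /B lerDr.
(* Subgradients within distance [1] of [xbar] have norm at most [B], so [q |-> <x, q.1> - q.2] has
   norm at most [B + 1], and [multiplier_bound] gives [Lam]. *)
pose Lam := 2 * KA * (B + 1).
have Lam0 : 0 <= Lam by rewrite !mulr_ge0//; lra.
have [rL rL0 [L L0 LP]] := C2_diff_lipschitz fV aU C2h.
pose K := 2 * Lam * L * (B + 1) * B.
exists K; first by rewrite !mulr_ge0// ?(ltW L0)//; lra.
move=> eps eps0.
(* The first bound makes the multiplier lemmas applicable; the second turns the coefficient of
   [|x - x'|] in the final remainder into at most [eps]. *)
pose e := Num.min (2^-1 / KA) (eps / (2 * KA * B)).
have e0 : 0 < e.
  by rewrite lt_min !divr_gt0// !mulr_gt0//; lra.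
have e_ge0 := ltW e0.
have eK : e * KA <= 2^-1 by rewrite -ler_pdivlMr// ge_min lexx.
have eeps : e * (2 * KA * B) <= eps.
  rewrite -ler_pdivlMr; first by rewrite ge_min lexx orbT.
  by rewrite !mulr_gt0//; lra.
have C1h := C2_C1 C2h.
have [r1 r10 strict] := C1_strict_diff fV aU C1h e0.
have [r2 r20 r2P] :=
  near_radius2 (open_nbhs_near aU) (C1_diff_near fV aU C1h e0).
pose rr := Num.min r1 (Num.min r2 rL).
have rr0 : 0 < rr by rewrite !lt_min r10 r20 rL0.
have BB : 0 < B + 1 by lra.
(* Values of [psi] vary by at most [B |z - zbar|] between points with such subgradients, so
   [(z, psi z)] stays within [(B + 1) |z - zbar|] of the base point. *)
exists (rr / (B + 1)); first by rewrite divr_gt0.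
have xB x : `|x - xbar| < 1 -> `|x| <= B.
  move=> xx; rewrite -[x](subrK xbar) (le_trans (ler_normD _ _))// /B; lra.
have one z x : `|z - zbar| < rr / (B + 1) -> `|x - xbar| < 1 ->
    subdiff psi z x ->
    exists b (l : W), [/\ psi z = b%:E, `|(z, b) - a| < rr, `|l| <= Lam &
      forall q, inner x q.1 - q.2 = inner l ('d h (z, b) q)].
  move=> zr xr zx; have [b zb] := subdiff_fin zx.
  have xbB : `|xbar| <= B by rewrite /B lerDl.
  have bb0 := subdiff_value_lipschitz zb psib zx xz (xB x xr) xbB.
  have va : `|(z, b) - a| < rr.
    apply: le_lt_trans (norm_pair_le _) _ => /=.
    apply: (@le_lt_trans _ _ ((B + 1) * `|z - zbar|)); first by lra.
    by rewrite mulrC -ltr_pdivlMr.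
  have := va; rewrite !lt_min => /and3P[va1 va2 _].
  have [Uv dhv] := r2P _ va2.
  have nlin : linear (fun q : X * R => inner x q.1 - q.2 : R^o).
    move=> k u v; rewrite innerDr innerZr.
    by rewrite -[k *: (_ : R^o)]/(k * _) -[(k *: u + v).2]/(k * u.2 + v.2); ring.
  pose n : {linear (X * R)%type -> R^o} :=
    HB.pack (fun q : X * R => inner x q.1 - q.2 : R^o)
      (GRing.isLinear.Build R (X * R)%type R^o _ _ nlin).
  have nK q : `|n q| <= (B + 1) * `|q|.
    apply: le_trans (ler_normB _ _) _; rewrite mulrDl mul1r lerD ?norm_snd//.
    rewrite (le_trans (norm_inner_le _ _))// ler_pM ?norm_fst//; exact: xB.
  have vU : open_nbhs (z, b) U by case: aU => oU _; split.
  have dv : differentiable h (z, b) by exact: (C1h _ Uv).1.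
  have vepi : (epi psi `&` U) (z, b) by split => //; rewrite /epi/= zb.
  have Chv : C (h (z, b)) by move: vepi; rewrite hC => -[].
  have nC q : U q -> C (h q) -> n (q - (z, b)) <= 0.
    move=> Uq Cq; have : (epi psi `&` U) q by rewrite hC.
    move=> [+ _]; rewrite /epi/=.
    move: (psiN q.1); case qs: (psi q.1) => [s||] // _; rewrite lee_fin => sq.
    have h1 := subdiffP zx zb qs.
    rewrite [leLHS](_ : _ = inner x (q.1 - z) - (q.2 - b))//.
    by rewrite subr_le0 lerBrDl (le_trans h1).
  have [l lE] := normal_multiplier DA KA0 AK eK e_ge0 strict nK vU va1 dv Chv
    nC dhv.
  exists b, l; split => //.
  exact: (multiplier_bound DA KA0 AK eK e_ge0 (ltW BB) nK dhv lE).
move=> z z' x x' zr zr' xr xr' zx zx'.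
have [b [l [zb va lL lE]]] := one z x zr xr zx.
have [b' [l' [zb' va' lL' lE']]] := one z' x' zr' xr' zx'.
set v := (z, b) in va lE *; set v' := (z', b') in va' lE' *.
have bb' := subdiff_value_lipschitz zb zb' zx zx' (xB x xr) (xB x' xr').
have vv' : `|v - v'| <= (B + 1) * `|z - z'|.
  by apply: le_trans (norm_pair_le _) _ => /=; lra.
have := va; rewrite !lt_min => /and3P[_ va2 va3].
have := va'; rewrite !lt_min => /and3P[_ _ va3'].
have [_ dhv] := r2P _ va2.
pose eta := l - l'; pose u := x - x'.
pose rho := e * `|eta| + Lam * (L * `|v - v'|).
have rho0 : 0 <= rho.
  by rewrite addr_ge0// ?mulr_ge0// ltW.
(* The two multiplier identities carry the same term [- q.2], which cancels: [eta] pulled back by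
   [D] is the horizontal functional [u] up to [rho]. *)
have est q : `|inner u q.1 - inner eta (D q)| <= rho * `|q|.
  have -> : inner u q.1 = (inner x q.1 - q.2) - (inner x' q.1 - q.2).
    by rewrite innerBl opprB addrA subrK.
  rewrite lE lE' inner_increment.
  rewrite mulrDl (le_trans (ler_normD _ _))// lerD//.
    rewrite (le_trans (norm_inner_le _ _))// (mulrC e) -mulrA ler_wpM2l//.
  apply: (le_trans (norm_inner_le l' _)); rewrite -mulrA; apply: ler_pM;
    [exact: normr_ge0|exact: normr_ge0|exact: lL'|exact: LP].
have s0 : 0 <= Lam * (L * `|v - v'|) by rewrite !mulr_ge0// ltW.
have eta_le : `|eta| <= 2 * KA * (`|u| + Lam * (L * `|v - v'|)).
  apply: (@multiplier_increment_bound _ e) => //.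
  have := est (A eta); rewrite DA inner_norm distrC => /(le_trans (ler_norm _)).
  rewrite lerBlDr expr2 addrC => /le_trans; apply; apply: lerD.
    rewrite (le_trans (ler_inner _ _))// ler_wpM2l//.
    exact: le_trans (norm_fst _) (AK _).
  by rewrite ler_wpM2l.
(* As [u] has no vertical component, [beta] is at most [rho]. The correction [beta *: xbar] costs
   [rho |xbar|], whence the factor [B = |xbar| + 1]. *)
have [y [beta yE]] := functional_pair D eta.
have beta_le : `|beta| <= rho.
  have := est (0, 1); rewrite /= yE !inner0r mulr1 !add0r normrN.
  have -> : `|(0 : X, 1 : R)| = 1.
    by rewrite prod_normE/= normr0 normr1; apply/max_idPr.
  by rewrite mulr1.
have uy : `|u - y| <= rho.
  apply: ler_norm_inner => // w; have := est (w, 0).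
  by rewrite /= yE mulr0 addr0 norm_pair0 -innerBl => /(le_trans (ler_norm _)).
exists (y + beta *: xbar).
  exact: (reducible_range psiN psib epiC xz aU dha hC h0 Ccone yE).
rewrite -/u opprD addrA (le_trans (ler_normB _ _))// normrZ.
have h1 : `|u - y| + `|beta| * `|xbar| <= rho * B.
  by rewrite /B mulrDr mulr1 addrC lerD// ler_wpM2r.
apply: le_trans h1 _.
have B0 : 0 <= B := le_trans ler01 B1.
apply: (le_trans (remainder_bound e_ge0 KA_ge0 B0 (normr_ge0 u) s0 eK eeps
  eta_le)).
rewrite lerD2l [leRHS](_ : _ =
  2 * (Lam * (L * ((B + 1) * `|z - z'|))) * B); last by rewrite /K; ring.
apply: ler_wpM2r => //; apply: ler_wpM2l => //; apply: ler_wpM2l => //.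
by apply: ler_wpM2l => //; exact: ltW.
Qed.

End ReducibleEstimate.

(** * Sensitivity analysis *)

Section Preliminaries.
Context {R : realType}.

Lemma pair_ball (V W : normedModType R) (x a : V) (p b : W) (r : R) :
  `|x - a| < r -> `|p - b| < r -> `|(x, p) - (a, b)| < r.
Proof. by move=> xr pr; rewrite prod_normE/= gt_max xr. Qed.

Lemma lipschitzP (V W : normedModType R) (s : V -> W) (U : set V) :
  [lipschitz s q | q in U] <->
  exists K : R, forall x y, U x -> U y -> `|s x - s y| <= K * `|x - y|.
Proof.
split=> [[M [_ MP]]|[K KP]].
  have M1 : M < M + 1 by rewrite ltrDl ltr01.
  by exists (M + 1) => x y Ux Uy; apply: (MP _ M1 (x, y)).
exists `|K|; split; first exact: normr_real.
move=> M KM [x y] [/= Ux Uy]; rewrite (le_trans (KP _ _ Ux Uy))//.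
by rewrite ler_wpM2r// (le_trans (ler_norm K))// ltW.
Qed.

Lemma injective_on_bounded_below (X Y : euclidType R) (A : {linear X -> Y})
    (S : {vspace X}) : (forall w, w \in S -> A w = 0 -> w = 0) ->
  exists2 c : R, 0 < c & forall y, y \in S -> `|y| <= c * `|A y|.
Proof.
move=> Ainj.
have gl : linear (fun w : subvs_of S => A (vsval w)).
  by move=> k u v; rewrite !linearP.
pose g' : {linear subvs_of S -> Y} := HB.pack (fun w : subvs_of S => A (vsval w))
  (GRing.isLinear.Build R (subvs_of S) Y _ _ gl).
pose g := linfun g'.
have g0 : lker g == 0%VS.
  apply/lker0P => x y; rewrite !lfunE/= => xy.
  apply/val_inj/eqP; rewrite -subr_eq0 -linearB; apply/eqP/Ainj.
    exact: subvsP.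
  by rewrite !linearB xy subrr.
have kl : linear (fun u : Y => vsval ((g^-1)%VF u)).
  by move=> k u v; rewrite !linearP.
pose k : {linear Y -> X} := HB.pack (fun u : Y => vsval ((g^-1)%VF u))
  (GRing.isLinear.Build R Y X _ _ kl).
have [c c0 cP] := finite_linear_bounded (finite_frame_euclid Y) k.
exists c => // y yS.
have {1}-> : y = k (A y); last exact: cP.
have -> : A y = g (vsproj S y) by rewrite lfunE /= vsprojK.
by rewrite /k /= lker0_lfunK// vsprojK.
Qed.

(** Evaluating the form at [u - M^-1 H u] replaces the use of a square root of [H]. *)
Lemma psd_norm_bound (X : euclidType R) (H : {linear X -> X}) (M : R) :
  0 < M -> (forall w, `|H w| <= M * `|w|) ->
  (forall u w, inner (H u) w = inner (H w) u) ->
  (forall u, 0 <= inner (H u) u) ->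
  forall u, `|H u| ^+ 2 <= M * inner (H u) u.
Proof.
move=> M0 HM Hsym Hpsd u.
have := Hpsd (u - M^-1 *: H u).
rewrite (linearB H) (linearZ_LR H) !innerBl !innerBr !innerZl !innerZr.
rewrite -[inner (H (H u)) u]Hsym inner_norm.
have h1 : inner (H (H u)) (H u) <= M * `|H u| ^+ 2.
  rewrite (le_trans (ler_inner _ _))// expr2 mulrA ler_wpM2r//; exact: HM.
move=> h2.
have h3 : M^-1 * (M^-1 * inner (H (H u)) (H u)) <= M^-1 * `|H u| ^+ 2.
  rewrite ler_pM2l ?invr_gt0// -(ler_pM2l M0) mulrA divff ?gt_eqF// mul1r//.
rewrite -ler_pdivrMl//; lra.
Qed.

(* Used with [u = |x - x'|], [Hu = |H (x - x')|], [Huu = <H (x - x'), x - x'>],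
   [z] and [d] the increments of the subgradient and of the parameters, and
   [uy] the distance from [x - x'] to an element of the parallel subspace.
   The weak coercivity [u <= c Hu + c1 uy] closes up because [Hu^2 <= M Huu]
   and monotonicity of the subdifferential bounds [Huu]. *)
Lemma lipschitz_bound_real (u Hu Huu d uy z M K c c1 e m : R) :
  0 <= u -> 0 <= Hu -> 0 <= d -> 0 < M -> 0 <= K -> 0 < c -> 0 < c1 ->
  0 < e -> 0 <= m ->
  c1 * K * e <= 4^-1 -> 8 * (c + c1 * K) ^+ 2 * M * e <= 4^-1 ->
  Hu ^+ 2 <= M * Huu -> Huu <= u * (e * u + m * d) ->
  z <= Hu + e * u + m * d ->
  u <= c * Hu + c1 * uy -> uy <= (4 * c1)^-1 * u + K * z ->
  u <= (16 * (c + c1 * K) ^+ 2 * M * m + 4 * (c1 * K * m)) * d.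
Proof.
move=> u0 Hu0 d0 M0 K0 c0 c10 e0 m0 e1 e2 hH hHuu hz hu huy.
set al := c + c1 * K in e2 *.
have al0 : 0 < al by rewrite ltr_wpDr// mulr_ge0// ltW.
have a1 : c1 * uy <= 4^-1 * u + c1 * K * z.
  have : c1 * uy <= c1 * ((4 * c1)^-1 * u + K * z) by rewrite ler_pM2l.
  have -> : c1 * ((4 * c1)^-1 * u + K * z) = 4^-1 * u + c1 * K * z.
    by field; rewrite gt_eqF.
  by [].
have c1K : 0 <= c1 * K by rewrite mulr_ge0// ltW.
have a2 : c1 * K * z <= c1 * K * (Hu + e * u + m * d) by rewrite ler_wpM2l.
have a3 : c1 * K * e * u <= 4^-1 * u by rewrite ler_wpM2r.
have a4 : u <= 2 * al * Hu + 2 * (c1 * K * m) * d by rewrite /al; lra.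
set be := c1 * K * m in a4 *.
have be0 : 0 <= be by rewrite mulr_ge0.
have a5 : Hu ^+ 2 <= M * (u * (e * u + m * d)).
  by apply: le_trans hH _; rewrite ler_pM2l.
have a6 : u ^+ 2 <= 8 * al ^+ 2 * Hu ^+ 2 + 8 * be ^+ 2 * d ^+ 2.
  apply: (@le_trans _ _ ((2 * al * Hu + 2 * be * d) ^+ 2)).
    rewrite ler_sqr ?nnegrE//.
    exact: le_trans u0 a4.
  have := sqr_ge0 (2 * al * Hu - 2 * be * d); lra.
have al2 : 0 <= 8 * al ^+ 2 by rewrite mulr_ge0 ?sqr_ge0.
have a7 := ler_wpM2l al2 a5.
set ga := 8 * al ^+ 2 * M * m.
have ga0 : 0 <= ga by rewrite !mulr_ge0// ltW.
have a8 : 8 * al ^+ 2 * M * e * u ^+ 2 <= 4^-1 * u ^+ 2.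
  by rewrite ler_wpM2r ?sqr_ge0.
have a9 : u ^+ 2 <= 4^-1 * u ^+ 2 + ga * u * d + 8 * be ^+ 2 * d ^+ 2.
  by rewrite /ga; lra.
have -> : 16 * al ^+ 2 * M * m = 2 * ga by rewrite /ga; ring.
rewrite -ler_sqr ?nnegrE//; last by rewrite !mulr_ge0// addr_ge0// mulr_ge0.
(* Young's inequality for [ga u d]: half of [u^2] is absorbed in all, leaving [u^2 <= (2 ga^2 + 16
   be^2) d^2 <= ((2 ga + 4 be) d)^2]. *)
have b1 := sqr_ge0 (u / 2 - ga * d).
have b2 : 0 <= ga * be * d ^+ 2 by rewrite mulr_ge0 ?sqr_ge0// mulr_ge0.
have b3 : 0 <= be ^+ 2 * d ^+ 2 by rewrite -exprMn sqr_ge0.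
have b4 : 0 <= ga ^+ 2 * d ^+ 2 by rewrite -exprMn sqr_ge0.
lra.
Qed.

End Preliminaries.

Section Sensitivity.
Context {R : realType} {X P : euclidType R}.
Variables (f : X * P -> \bar R) (g : X -> \bar R) (pbar : P) (xbar zbar : X).
Hypotheses (f_noNy : noNy f) (g_noNy : noNy g) (g_closed : closed_fun g)
  (g_convex : convex_fun g)
  (xbar_dom : (dom (fun x => f (x, pbar)) `&` dom g) xbar)
  (xbar_opt : argmin (fun x => f (x, pbar) + g x)%E [set: X] xbar)
  (f_convex : convex_fun (fun x => f (x, pbar))).
Let F (q : X * P) : R := fine (f q).
Variables (U : set (X * P)) (G : X * P -> X) (H : {linear X -> X}).
Hypotheses (aU : open_nbhs (xbar, pbar) U)
  (f_fin : forall q, U q -> f q \is a fin_num)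
  (F_C1 : C1_on F U) (GE : forall q v, 'd F q (v, 0) = inner (G q) v)
  (G_C1 : C1_on G U) (HE : forall u, H u = 'd G (xbar, pbar) (u, 0))
  (zbarE : zbar = - G (xbar, pbar)).

Lemma slice_near x p : U (x, p) -> \forall y \near x, U (y, p).
Proof.
move=> Uxp; have oxp : open_nbhs (x, p) U by case: aU => oU _; split.
have /near_radius[r r0 rP] := open_nbhs_near oxp.
by apply: (radius_near r0) => y yr; apply: rP; rewrite subr_pair norm_pair0.
Qed.

Lemma fE q : U q -> f q = (F q)%:E.
Proof. by move=> /f_fin/fineK ->. Qed.

Lemma tiltedE v p x : U (x, p) ->
  tilted f g v p x = (g x + (F (x, p) - inner v x)%:E)%E.
Proof. by move=> Uxp; rewrite /tilted fE// EFinB addeCA addeA. Qed.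

Lemma F_slice_diff x p : U (x, p) ->
  differentiable (fun y => F (y, p)) x /\
  forall v, 'd (fun y => F (y, p)) x v = inner (G (x, p)) v.
Proof.
move=> Uxp; have [d dE] := slice_diff (F_C1 Uxp).1.
by split => // v; rewrite dE GE.
Qed.

Lemma local_min_subdiff v p x : U (x, p) -> (g x < +oo)%E ->
  (\forall y \near x, tilted f g v p x <= tilted f g v p y)%E ->
  subdiff g x (v - G (x, p)).
Proof.
move=> Uxp gx xmin; rewrite -opprB.
apply: (@convex_local_min_subdiff _ _ _ (fun y => F (y, p) - inner v y)) => //.
  move=> e e0; have [d dE] := F_slice_diff Uxp.
  apply: filterS (diff_approx d e0) => y.
  rewrite dE ler_norml innerBl (innerBr v) => /andP[_]; lra.
apply: filterS2 (slice_near Uxp) xmin => y Uyp.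
by rewrite !tiltedE.
Qed.

Let Ua : U (xbar, pbar). Proof. by case: aU. Qed.

Lemma xbar_tilted y : (tilted f g 0%R pbar xbar <= tilted f g 0%R pbar y)%E.
Proof.
by rewrite /tilted !inner0l !sube0; case: xbar_opt => _ _; apply.
Qed.

Lemma subdiff_xbar : subdiff g xbar zbar.
Proof.
rewrite zbarE -sub0r; apply: local_min_subdiff => //; first by case: xbar_dom.
by apply: filterE => y; exact: xbar_tilted.
Qed.

Lemma fin_radius : exists2 r : R, 0 < r & forall x p,
  `|x - xbar| < r -> `|p - pbar| < r -> U (x, p).
Proof.
have /near_radius[r r0 rP] := open_nbhs_near aU.
by exists r => // x p xr pr; apply: rP; exact: pair_ball.
Qed.

Lemma f_subdiff x p : noNy (fun x => f (x, p)) ->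
  convex_fun (fun x => f (x, p)) -> U (x, p) ->
  subdiff (fun x => f (x, p)) x (G (x, p)).
Proof.
move=> fN fC Uxp; have [d dE] := F_slice_diff Uxp.
apply: convex_diff_subdiff => //.
by apply: filterS (slice_near Uxp) => y; exact: f_fin.
Qed.

Lemma G_strict (e : R) : 0 < e -> exists2 r : R, 0 < r & forall x y p q,
  `|x - xbar| < r -> `|y - xbar| < r -> `|p - pbar| < r -> `|q - pbar| < r ->
  `|G (y, q) - G (x, p) - 'd G (xbar, pbar) (y - x, q - p)|
  <= e * (`|y - x| + `|q - p|).
Proof.
move=> e0; have [r r0 rP] := C1_strict_diff (@finite_frame_pair R X P) aU G_C1 e0.
exists r => // x y p q xr yr pr qr.
have := rP _ _ (pair_ball xr pr) (pair_ball yr qr).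
by move=> /le_trans; apply; rewrite ler_pM2l//; exact: (norm_pair_le (_, _)).
Qed.

Lemma G_strict_slice (e : R) : 0 < e -> exists2 r : R, 0 < r & forall x y,
  `|x - xbar| < r -> `|y - xbar| < r ->
  `|G (y, pbar) - G (x, pbar) - H (y - x)| <= e * `|y - x|.
Proof.
move=> e0; have [r r0 rP] := G_strict e0.
exists r => // x y xr yr; have := rP x y pbar pbar xr yr.
by rewrite subrr normr0 addr0 -HE; apply.
Qed.

Lemma H_sym u w : inner (H u) w = inner (H w) u.
Proof.
apply: (strict_hessian_sym (phi := fun x => F (x, pbar))
  (Gam := fun x => G (x, pbar)) (a := xbar)); last exact: G_strict_slice.
by apply: filterS (slice_near Ua) => x; exact: F_slice_diff.
Qed.

(** Monotonicity of the gradient of [f (., pbar)] between [xbar] and [xbar + s u], divided by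
    [s^2]. *)
Lemma H_psd u : 0 <= inner (H u) u.
Proof.
rewrite -oppr_le0; apply/ler_addgt0Pr => e e0; rewrite add0r.
have u1 : 0 < `|u| ^+ 2 + 1 by rewrite ltr_wpDl// sqr_ge0.
have e'0 : 0 < e / (`|u| ^+ 2 + 1) by rewrite divr_gt0.
have [r r0 rP] := G_strict_slice e'0.
have [r1 r10 r1P] := fin_radius.
have uu : 0 < `|u| + 1 by rewrite ltr_wpDl.
pose m := Num.min r r1.
have m0 : 0 < m by rewrite lt_min r0.
have [s s0 [_ sm]] := small_scale uu m0.
have su : `|s *: u| < m.
  by rewrite normrZ gtr0_norm// (le_lt_trans _ sm)// ler_pM2l// lerDl.
have xs : xbar + s *: u - xbar = s *: u by rewrite addrC addKr.
move: su; rewrite lt_min => /andP[sr sr1].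
have h1 := rP xbar (xbar + s *: u).
rewrite subrr normr0 xs in h1; have {}h1 := h1 r0 sr.
have Us : U (xbar + s *: u, pbar).
  by apply: r1P; rewrite ?xs ?subrr ?normr0.
have h2 := subdiff_monotone (f_subdiff (fun _ => f_noNy _) f_convex Us)
  (f_subdiff (fun _ => f_noNy _) f_convex Ua).
rewrite xs in h2.
have h3 := le_trans (norm_inner_le (s *: u) _) (ler_wpM2l (normr_ge0 (s *: u)) h1).
move: h2 h3; rewrite (innerBr (s *: u) (_ - _)) ler_norml.
rewrite (linearZ_LR H) !normrZ gtr0_norm// !innerZl !innerZr (innerC u (H u)).
move=> h2 /andP[_ h3].
have h4 : s * (s * - inner (H u) u) <= s * (s * (e / (`|u| ^+ 2 + 1) * `|u| ^+ 2)).
  by lra.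
move: h4; rewrite !ler_pM2l// => /le_trans; apply.
by rewrite mulrAC ler_pdivrMr// ler_pM2l// lerDl.
Qed.

Let par_dir := scaled_diff (subdiff (conjugate g) zbar).

Lemma conj_noNy : noNy (conjugate g).
Proof. exact: conjugate_noNy subdiff_xbar. Qed.

Lemma tilt_stable_kernel w : tilt_stable f g pbar xbar -> H w = 0 ->
  par_dir w -> w = 0.
Proof.
move=> [gam gam0 [[N [s [N0 MN /lipschitzP[L LP]]]] _]] Hw0.
move=> [c _ [a [b [Fa Fb wE]]]].
have [c0|c0] := eqVneq c 0; first by rewrite wE c0 scale0r.
have Hab : H (a - b) = 0.
  have : c *: H (a - b) = 0 by rewrite -linearZ -wE.
  by move=> /eqP; rewrite scaler_eq0 (negbTE c0) => /eqP.
suff : `|a - b| <= 0 by rewrite normr_le0 wE => /eqP ->; rewrite scaler0.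
have Fx := subdiff_conjugate subdiff_xbar.
pose pt (t : R) (y : X) := t *: y + (1 - t) *: xbar.
have Fpt t y : 0 <= t <= 1 -> subdiff (conjugate g) zbar y ->
    subdiff g (pt t y) zbar.
  move=> t01 Fy; apply: (conjugate_subdiff_inv g_noNy g_closed g_convex
    subdiff_xbar).
  exact: subdiff_convex conj_noNy Fy Fx.
have ptE t y : pt t y - xbar = t *: (y - xbar).
  by rewrite /pt scalerBl scale1r scalerBr addrCA addrAC subrr add0r.
have e0 : 0 < (2 * (`|L| + 1))^-1 by rewrite invr_gt0 mulr_gt0// ltr_wpDl.
(* With this [e] the Lipschitz bound on [s] reads [t |a - b| <= t |a - b| / 2]. *)
set e := (2 * (`|L| + 1))^-1 in e0.
have [r1 r10 strict] := G_strict_slice e0.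
have [r2 r20 r2P] := fin_radius.
have [r3 r30 r3P] := near_radius N0.
have [KH KH0 KHP] := finite_linear_bounded (finite_frame_euclid X) H.
pose r4 := r3 / (KH + e).
have KHe : 0 < KH + e by rewrite addr_gt0.
pose m := Num.min (Num.min r1 r2) (Num.min r4 gam).
have m0 : 0 < m by rewrite !lt_min r10 r20 gam0 divr_gt0.
pose D := `|a - xbar| + `|b - xbar| + 1.
have D0 : 0 < D by rewrite ltr_wpDl// addr_ge0.
have [t t0 [t1 tm]] := small_scale D0 m0.
have t01 : 0 <= t <= 1 by rewrite ltW.
have key y : subdiff (conjugate g) zbar y -> `|y - xbar| <= D ->
    `|pt t y - xbar| < r1 /\
    N (G (pt t y, pbar) + zbar) /\ pt t y = s (G (pt t y, pbar) + zbar).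
  move=> Fy yD.
  have : `|pt t y - xbar| < m.
    rewrite ptE normrZ gtr0_norm//; apply: le_lt_trans tm.
    by rewrite ler_pM2l.
  rewrite !lt_min -andbA => /and4P[yr1 yr2 yr4 ygam]; split => //.
  have Ny : N (G (pt t y, pbar) + zbar).
    apply: r3P; rewrite subr0 zbarE.
    have h := strict xbar (pt t y); rewrite subrr normr0 in h.
    have {}h := h r10 yr1.
    have h' := ler_normD (G (pt t y, pbar) - G (xbar, pbar) - H (pt t y - xbar))
      (H (pt t y - xbar)).
    rewrite subrK in h'; apply: le_lt_trans h' _.
    apply: (@le_lt_trans _ _ ((KH + e) * `|pt t y - xbar|)).
      by rewrite mulrDl addrC lerD.
    by rewrite mulrC -ltr_pdivlMr.
  split => //.
  (* The subgradient [G] of the convex [f (., pbar)] and the subgradient [zbar] of [g] add up to the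
     tilt, so the point is a global minimiser. *)
  have : Mgamma f g xbar gam (G (pt t y, pbar) + zbar, pbar) (pt t y).
    have Uy : U (pt t y, pbar) by apply: r2P => //; rewrite subrr normr0.
    have gy := Fpt t y t01 Fy; have [cg cgE] := subdiff_fin gy.
    have fy := f_subdiff (fun _ => f_noNy _) f_convex Uy.
    split => /=.
    - by rewrite closed_ballE// /closed_ball_/= distrC ltW.
    - by rewrite tiltedE// cgE -EFinD ltry.
    move=> z _; rewrite /tilted cgE fE//.
    have := f_noNy (z, pbar); have := g_noNy z.
    case fz : (f (z, pbar)) => [fr||] //; case gz : (g z) => [gr||] //= _ _;
      rewrite ?leey//.
    rewrite -!EFinD lee_fin.
    have h1 := subdiffP fy (fE Uy) fz; have h2 := subdiffP gy cgE gz.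
    by move: h1 h2; rewrite !innerBr !innerDl; lra.
  by have /= -> := MN _ Ny.
have aD : `|a - xbar| <= D.
  by rewrite /D -addrA lerDl addr_ge0.
have bD : `|b - xbar| <= D.
  by rewrite /D addrAC lerDr addr_ge0.
have [ar [Na as_]] := key a Fa aD; have [br [Nb bs]] := key b Fb bD.
have pab : pt t a - pt t b = t *: (a - b).
  by rewrite /pt opprD addrACA subrr addr0 scalerBr.
have h1 := LP _ _ Na Nb; rewrite -as_ -bs pab in h1.
rewrite (opprD (G _)) addrACA subrr addr0 in h1.
have h2 := strict _ _ br ar.
rewrite pab (linearZ_LR H) Hab scaler0 subr0 in h2.
move: h1 h2; rewrite normrZ gtr0_norm//; set d := `|a - b|; set Gd := `|_ - _|.
move=> h1 h2.
have Gd0 : 0 <= Gd by exact: normr_ge0.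
have h3 : L * Gd <= (`|L| + 1) * (e * (t * d)).
  apply: (@le_trans _ _ (`|L| * Gd)).
    by rewrite ler_wpM2r ?ler_norm.
  by apply: ler_pM h2 => //; rewrite lerDl.
have L1 : 0 < `|L| + 1 by rewrite ltr_wpDl.
have h4 : (`|L| + 1) * (e * (t * d)) = t * (d / 2).
  by rewrite /e; field; rewrite gt_eqF.
have : t * d <= t * (d / 2) by rewrite -h4; exact: le_trans h1 h3.
by rewrite ler_pM2l//; lra.
Qed.


Lemma par_dir_linear : linear_subset par_dir.
Proof.
have Fx := subdiff_conjugate subdiff_xbar.
split=> [|k u v Du Dv].
  by exists 0 => //; exists xbar, xbar; rewrite scale0r.
apply: scaled_diffD => //; last exact: scaled_diffZ.
by move=> u' v' t t01; apply: subdiff_convex => //; exact: conj_noNy.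
Qed.

Hypotheses (g_reducible : C2_cone_reducible_fun (conjugate g) zbar)
  (kernel : forall w, H w = 0 -> par_dir w -> w = 0).

Lemma G_lipschitz : exists2 r : R, 0 < r & exists2 K : R, 0 < K &
  forall x p, `|x - xbar| < r -> `|p - pbar| < r ->
    `|G (x, p) - G (xbar, pbar)| <= K * (`|x - xbar| + `|p - pbar|).
Proof.
have [r r0 [K K0 KP]] := C1_lipschitz (@finite_frame_pair R X P) aU G_C1.
exists r => //; exists K => // x p xr pr.
have aa : `|(xbar, pbar) - (xbar, pbar)| < r by rewrite subrr normr0.
have := KP _ _ aa (pair_ball xr pr) => /le_trans; apply.
by rewrite ler_pM2l//; exact: (norm_pair_le (_, _)).
Qed.

Lemma solution_lipschitz : exists2 r : R, 0 < r & exists2 C : R, 0 <= C &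
  forall x x' p p' v v',
    `|x - xbar| < r -> `|x' - xbar| < r -> `|p - pbar| < r ->
    `|p' - pbar| < r -> `|v| < r -> `|v'| < r ->
    subdiff g x (v - G (x, p)) -> subdiff g x' (v' - G (x', p')) ->
    `|x - x'| <= C * (`|v - v'| + `|p - p'|).
Proof.
have [S SE] := linear_subset_vspace par_dir_linear.
have [c c0 cP] : exists2 c : R, 0 < c & forall y, y \in S -> `|y| <= c * `|H y|.
  by apply: injective_on_bounded_below => w /SE Sw Hw; exact: kernel.
have [M M0 MP] := finite_linear_bounded (@finite_frame_pair R X P)
  ('d G (xbar, pbar)).
have M_ge0 := ltW M0.
have HM w : `|H w| <= M * `|w| by rewrite HE -(norm_pair0 P w).
have [K K0 KP] := reducible_subdiff_estimate conj_noNy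
  (fun p q t => @epi_conjugate_convex R X g p q t g_noNy)
  (subdiff_conjugate subdiff_xbar) g_reducible.
(* For [y] in the parallel subspace, [|u| <= c |H y| + |u - y| <= c |H u| + (c M + 1) |u - y|]. The
   constant [e1] below is chosen so that [e = e1^-1] meets both smallness conditions of
   [lipschitz_bound_real]. *)
pose c1 := c * M + 1; pose m := 2 + M.
have c10 : 0 < c1 by rewrite ltr_wpDl// mulr_ge0// ltW.
have m0 : 0 <= m by rewrite addr_ge0.
pose e1 := 4 * (c1 * K) + 32 * ((c + c1 * K) ^+ 2 * M) + 1.
have c1K : 0 <= c1 * K by rewrite mulr_ge0// ltW.
have alM : 0 <= (c + c1 * K) ^+ 2 * M by rewrite mulr_ge0// sqr_ge0.
have e10 : 0 < e1 by rewrite /e1; lra.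
pose e := e1^-1.
have e0 : 0 < e by rewrite invr_gt0.
have ee1 : e * e1 = 1 by rewrite mulVf// gt_eqF.
have e_le1 : e <= 1 by rewrite -ee1 ler_peMr ?(ltW e0)// /e1; lra.
have h1 : c1 * K * e <= 4^-1.
  have : e * (4 * (c1 * K)) <= e * e1 by rewrite ler_pM2l// /e1; lra.
  by rewrite ee1; lra.
have h2 : 8 * (c + c1 * K) ^+ 2 * M * e <= 4^-1.
  have : e * (32 * ((c + c1 * K) ^+ 2 * M)) <= e * e1.
    by rewrite ler_pM2l// /e1; lra.
  by rewrite ee1; lra.
have c14 : 0 < (4 * c1)^-1 by rewrite invr_gt0 mulr_gt0.
have [r1 r10 r1P] := KP _ c14.
have [r2 r20 strict] := G_strict e0.
have [r3 r30 [L L0 LP]] := G_lipschitz.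
have L1 : 0 < 1 + 2 * L by rewrite addr_gt0// mulr_gt0.
pose r := Num.min (Num.min 1 (r1 / (1 + 2 * L))) (Num.min r2 r3).
have r_gt0 : 0 < r by rewrite !lt_min ltr01 r20 r30 divr_gt0.
exists r => //.
exists (16 * (c + c1 * K) ^+ 2 * M * m + 4 * (c1 * K * m)).
  apply: addr_ge0; last by rewrite mulr_ge0// mulr_ge0.
  by rewrite mulr_ge0// -mulrA mulr_ge0.
have zclose x p v : `|x - xbar| < r -> `|p - pbar| < r -> `|v| < r ->
    `|v - G (x, p) - zbar| < r1.
  move=> xr pr vr.
  have [xr3 pr3] : `|x - xbar| < r3 /\ `|p - pbar| < r3.
    by move: xr pr; rewrite !lt_min => /andP[_ /andP[_ ->]] /andP[_ /andP[_ ->]].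
  have rr1 : r * (1 + 2 * L) <= r1.
    by rewrite -ler_pdivlMr// /r !ge_min lexx orbT.
  have -> : v - G (x, p) - zbar = v - (G (x, p) - G (xbar, pbar)).
    by rewrite zbarE opprK opprB addrA addrAC.
  have hG := LP x p xr3 pr3.
  have : L * (`|x - xbar| + `|p - pbar|) <= L * (r + r).
    by rewrite ler_pM2l// lerD// ltW.
  by move: (ler_normB v (G (x, p) - G (xbar, pbar))); lra.
move=> x x' p p' v v' xr xr' pr pr' vr vr' zx zx'.
have small t : t < r -> t < 1 /\ t < r2.
  by rewrite !lt_min => /andP[/andP[-> _] /andP[-> _]].
have [xr1 xr2] := small _ xr; have [xr1' xr2'] := small _ xr'.
have [_ pr2] := small _ pr; have [_ pr2'] := small _ pr'.
set z := v - G (x, p) in zx; set z' := v' - G (x', p') in zx'.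
have [y Dy yest] := r1P z z' x x' (zclose _ _ _ xr pr vr)
  (zclose _ _ _ xr' pr' vr') xr1 xr1' (subdiff_conjugate zx)
  (subdiff_conjugate zx').
have mono := subdiff_monotone zx zx'.
have str := strict x' x p' p xr2' xr2 pr2' pr2.
set u := x - x' in yest mono str *.
pose w0 := G (x, p) - G (x', p') - H u.
have w0_le : `|w0| <= e * `|u| + (1 + M) * `|p - p'|.
  pose w1 := 'd G (xbar, pbar) (0, p - p').
  have w1E : 'd G (xbar, pbar) (u, p - p') = H u + w1.
    rewrite HE /w1 -linearD; congr ('d G _ _).
    by rewrite -[RHS]/(_, _)/= addr0 add0r.
  have w1_le : `|w1| <= M * `|p - p'|.
    apply: le_trans (MP _) _; rewrite ler_pM2l// prod_normE/= normr0.
    by rewrite ge_max normr_ge0 lexx.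
  rewrite w1E opprD addrA -/w0 in str.
  have := ler_normD (w0 - w1) w1; rewrite subrK.
  have : e * `|p - p'| <= `|p - p'| by rewrite ler_piMl.
  move: str w1_le; lra.
have zE : z - z' = (v - v') - w0 - H u.
  by apply: inner_eq => t; rewrite /z /z' /w0 !innerBl; ring.
set d := `|v - v'| + `|p - p'|.
have d0 : 0 <= d by rewrite addr_ge0.
have w0d : `|v - v'| + `|w0| <= e * `|u| + m * d.
  apply: le_trans (lerD (lexx _) w0_le) _; rewrite addrCA lerD2l /m /d.
  have := mulr_ge0 M_ge0 (normr_ge0 (v - v')); have := normr_ge0 (p - p').
  by have := normr_ge0 (v - v'); lra.
have vw : `|(v - v') - w0| <= e * `|u| + m * d.
  exact: le_trans (ler_normB _ _) w0d.
apply: (lipschitz_bound_real (Hu := `|H u|) (Huu := inner (H u) u) (e := e)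
  (uy := `|u - y|) (z := `|z - z'|)) => //.
- exact: (psd_norm_bound M0 HM H_sym H_psd).
- move: mono; rewrite zE innerBr subr_ge0 (innerC u (H u)) => /le_trans; apply.
  by apply: le_trans (ler_inner _ _) _; rewrite ler_wpM2l.
- rewrite zE; apply: le_trans (ler_normB _ _) _.
  by rewrite -[leRHS]addrA [leRHS]addrC lerD2r.
rewrite -{1}[u](subrK y) addrC; apply: le_trans (ler_normD _ _) _.
have hy := cP y ((SE y).1 Dy).
have Hy : `|H y| <= `|H u| + M * `|u - y|.
  have -> : H y = H u - H (u - y) by rewrite -linearB opprB addrC subrK.
  by apply: le_trans (ler_normB _ _) _; rewrite lerD2l.
have cHy : c * `|H y| <= c * (`|H u| + M * `|u - y|) by rewrite ler_pM2l.
by apply: le_trans (lerD hy (lexx _)) _; rewrite /c1; lra.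
Qed.


Lemma good_radius : exists (r C L : R), [/\ 0 < r, 0 <= C, 0 <= L,
    forall x p, `|x - xbar| < r -> `|p - pbar| < r -> U (x, p) &
    (forall x x' p p' v v',
      `|x - xbar| < r -> `|x' - xbar| < r -> `|p - pbar| < r ->
      `|p' - pbar| < r -> `|v| < r -> `|v'| < r ->
      subdiff g x (v - G (x, p)) -> subdiff g x' (v' - G (x', p')) ->
      `|x - x'| <= C * (`|v - v'| + `|p - p'|)) /\
    forall x p p', `|x - xbar| < r -> `|p - pbar| < r -> `|p' - pbar| < r ->
      `|F (x, p) - F (x, p')| <= L * `|p - p'|].
Proof.
have [r1 r10 r1P] := fin_radius.
have [r2 r20 [C C0 CP]] := solution_lipschitz.
have [r3 r30 [L L0 LP]] :=
  C1_lipschitz_real (@finite_frame_pair R X P) aU F_C1.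
exists (Num.min r1 (Num.min r2 r3)), C, L; split => //.
- by rewrite !lt_min r10 r20.
- exact: ltW.
- by move=> x p; rewrite !lt_min => /andP[xr _] /andP[pr _]; exact: r1P.
split=> [x x' p p' v v'|x p p'].
  rewrite !lt_min => /and3P[_ ? _] /and3P[_ ? _] /and3P[_ ? _].
  by move=> /and3P[_ ? _] /and3P[_ ? _] /and3P[_ ? _]; exact: CP.
rewrite !lt_min => /and3P[_ _ xr] /and3P[_ _ pr] /and3P[_ _ pr'].
apply: le_trans (LP _ _ (pair_ball xr pr') (pair_ball xr pr)) _.
rewrite ler_pM2l// prod_normE/= subrr normr0.
by rewrite ge_max normr_ge0 lexx.
Qed.

(** * Existence, uniqueness and stability of minimisers over a small ball *)

Section LocalAnalysis.
Variables (r C L : R).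
Hypotheses (r_gt0 : 0 < r) (C_ge0 : 0 <= C) (L_ge0 : 0 <= L)
  (rU : forall x p, `|x - xbar| < r -> `|p - pbar| < r -> U (x, p))
  (rC : forall x x' p p' v v',
      `|x - xbar| < r -> `|x' - xbar| < r -> `|p - pbar| < r ->
      `|p' - pbar| < r -> `|v| < r -> `|v'| < r ->
      subdiff g x (v - G (x, p)) -> subdiff g x' (v' - G (x', p')) ->
      `|x - x'| <= C * (`|v - v'| + `|p - p'|))
  (rL : forall x p p', `|x - xbar| < r -> `|p - pbar| < r ->
      `|p' - pbar| < r -> `|F (x, p) - F (x, p')| <= L * `|p - p'|).

(** The other minimiser [y] may lie outside the range of the local estimate. By convexity, points of
    the segment close to [x] are minimisers too, and the estimate with equal data identifies them
    with [x]. *)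
Lemma convex_argmin_unique p x y : `|p - pbar| < r -> `|x - xbar| < r ->
  convex_fun (fun x => f (x, p)) ->
  argmin (fun x => f (x, p) + g x)%E [set: X] x ->
  (f (y, p) + g y <= f (x, p) + g x)%E -> y = x.
Proof.
move=> pr xr fC [_ xfin xmin] yx.
have Uxp := rU xr pr.
have [c xc] : exists c : R, (f (x, p) + g x = c%:E)%E.
  rewrite fE//; move: xfin; rewrite fE//.
  move: (g_noNy x); case: (g x) => [b||] // _ _.
  by exists (F (x, p) + b).
have sub z : `|z - xbar| < r -> (f (z, p) + g z <= c%:E)%E ->
    subdiff g z (0 - G (z, p)).
  move=> zr zc; have Uzp := rU zr pr; apply: local_min_subdiff => //.
    move: zc; rewrite fE//; move: (g_noNy z); case: (g z) => // b _ _.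
    by rewrite ltry.
  apply: filterE => w; rewrite /tilted !inner0l !sube0.
  by rewrite (le_trans zc)// -xc; exact: xmin.
have yx1 : 0 < `|y - x| + 1 by rewrite ltr_wpDl.
have s0 : 0 < r - `|x - xbar| by rewrite subr_gt0.
have [t t0 [t1 ts]] := small_scale yx1 s0.
pose z := t *: y + (1 - t) *: x.
have zx : z - x = t *: (y - x).
  by rewrite /z scalerBl scale1r scalerBr addrCA addrAC subrr add0r.
have zxn : `|z - x| = t * `|y - x| by rewrite zx normrZ gtr0_norm.
have zr : `|z - xbar| < r.
  apply: le_lt_trans (ler_distD x _ _) _; rewrite zxn -ltrBrDr.
  by apply: le_lt_trans ts; rewrite ler_pM2l// lerDl.
have zc : (f (z, p) + g z <= c%:E)%E.
  by apply: (@convex_sum_sublevel R X (fun x => f (x, p)) g) => //;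
    rewrite ?(ltW t0)// -xc.
have n0 : `|0 : X| < r by rewrite normr0.
have := rC zr xr pr pr n0 n0 (sub z zr zc).
rewrite xc in yx; have xcx : (f (x, p) + g x <= c%:E)%E by rewrite xc.
move=> /(_ (sub x xr xcx)); rewrite !subrr !normr0 addr0 mulr0 zxn.
rewrite pmulr_rle0// normr_le0 subr_eq0 => /eqP //.
Qed.

Let gam := r / 2.
Let gam_gt0 : 0 < gam. Proof. by rewrite divr_gt0. Qed.
Let gam_ltr : gam < r. Proof. by rewrite /gam; move: r_gt0; lra. Qed.

Lemma cballP x : closed_ball xbar gam x <-> `|x - xbar| <= gam.
Proof. by rewrite closed_ballE// /closed_ball_/= distrC. Qed.

Lemma ball_compact (A : set X) : closed A -> A `<=` closed_ball xbar gam ->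
  compact A.
Proof.
move=> cA Ab; apply: (@closed_bounded_compact _ _ _ (gam + `|xbar|)) => // x Ax.
rewrite -[x](subrK xbar) (le_trans (ler_normD _ _))// lerD2r.
exact/cballP/Ab.
Qed.

Lemma tilted_continuous v p x : `|x - xbar| <= gam -> `|p - pbar| < r ->
  {for x, continuous (fun y => F (y, p) - inner v y)}.
Proof.
move=> xg pr; have Uxp : U (x, p) by apply: rU => //; exact: le_lt_trans gam_ltr.
apply: continuousB.
  exact: (differentiable_continuous (F_slice_diff Uxp).1).
exact: (@finite_linear_continuous _ _ _ (finite_frame_euclid X)).
Qed.

Lemma tilted_min (A : set X) v p : closed A -> A !=set0 ->
  A `<=` closed_ball xbar gam -> `|p - pbar| < r ->
  exists2 x, A x & forall y, A y -> (tilted f g v p x <= tilted f g v p y)%E.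
Proof.
move=> cA A0 Ab pr.
have [x Ax xmin] := closed_fun_add_min (k := fun y => F (y, p) - inner v y)
  g_closed g_noNy (ball_compact cA Ab) A0
  (fun x Ax => @tilted_continuous v p x ((cballP x).1 (Ab x Ax)) pr).
have AU y : A y -> U (y, p).
  by move=> /Ab/cballP yg; apply: rU => //; exact: le_lt_trans gam_ltr.
by exists x => // y Ay; rewrite !tiltedE ?xmin//; exact: AU.
Qed.

Lemma tilted_xbar_fin v p : `|p - pbar| < r -> (tilted f g v p xbar < +oo)%E.
Proof.
move=> pr; rewrite tiltedE; last by apply: rU => //; rewrite subrr normr0.
by have [a ->] := subdiff_fin subdiff_xbar; rewrite -EFinD ltry.
Qed.

Lemma Mgamma_nonempty v p : `|p - pbar| < r ->
  exists x, Mgamma f g xbar gam (v, p) x.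
Proof.
move=> pr; have bx : closed_ball xbar gam xbar.
  by apply/cballP; rewrite subrr normr0 ltW.
have cb : closed (closed_ball xbar gam) by exact: closed_ball_closed.
have [x bxx xmin] := @tilted_min _ v p cb (ex_intro _ xbar bx)
  (fun _ h => h) pr.
exists x; split => //=.
exact: le_lt_trans (xmin _ bx) (tilted_xbar_fin v pr).
Qed.

Lemma tilted_interior_subdiff v p x : `|p - pbar| < r -> `|x - xbar| < gam ->
  Mgamma f g xbar gam (v, p) x -> subdiff g x (v - G (x, p)).
Proof.
move=> pr xg [/= _ xfin xmin].
have Uxp : U (x, p) by apply: rU => //; exact: lt_trans gam_ltr.
apply: local_min_subdiff => //.
  move: xfin; rewrite tiltedE//; move: (g_noNy x).
  by case: (g x) => // b _ _; rewrite ltry.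
have s0 : 0 < gam - `|x - xbar| by rewrite subr_gt0.
apply: (radius_near s0) => y ys; apply: xmin; apply/cballP.
apply: le_trans (ler_distD x _ _) _; rewrite -lerBrDr; exact: ltW.
Qed.

(* The value of the unperturbed problem on the sphere exceeds the optimal value
   by a fixed gap, which small perturbations cannot bridge. *)
Lemma Mgamma_interior : exists2 rho : R, 0 < rho <= r & forall v p x,
  `|v| < rho -> `|p - pbar| < rho -> Mgamma f g xbar gam (v, p) x ->
  `|x - xbar| < gam.
Proof.
pose A := [set x : X | `|x - xbar| = gam].
have Ab : A `<=` closed_ball xbar gam by move=> x Ax; apply/cballP; rewrite Ax.
have onA x : closed_ball xbar gam x -> ~~ (`|x - xbar| < gam) -> A x.
  by move=> /cballP xg; rewrite -leNgt => gx; apply/le_anti; rewrite xg.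
have cA : closed A.
  apply: (@closed_comp _ _ (fun x : X => `|x - xbar|) [set x : R | x = gam]).
    move=> x _.
    apply: (@continuous_comp _ _ _ (fun y => y - xbar) Num.norm).
      by apply: continuousB; [exact: cvg_id|exact: cst_continuous].
    exact: norm_continuous.
  exact: closed_eq.
have pbr : `|pbar - pbar| < r by rewrite subrr normr0.
(* In dimension zero the sphere is empty and every point of the ball is interior. *)
have [A0|A0] := pselect (A !=set0); last first.
  exists r => [|v p x _ _ [/= bx _ _]]; first by rewrite r_gt0 lexx.
  by rewrite ltNge; apply/negP => gx; apply: A0; exists x;
     apply: onA => //; rewrite -leNgt.
have [x1 Ax1 x1min] := tilted_min 0 cA A0 Ab pbr.
have x1lt : (tilted f g 0%R pbar xbar < tilted f g 0%R pbar x1)%E.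
  rewrite ltNge; apply/negP; rewrite /tilted !inner0l !sube0 => x1le.
  have x1E : x1 = xbar.
    by apply: convex_argmin_unique pbr _ f_convex xbar_opt x1le;
       rewrite subrr normr0.
  by move: Ax1; rewrite /A/= x1E subrr normr0 => g0; move: gam_gt0; rewrite -g0 ltxx.
have [c [cx cx1]] := lte_real_between x1lt.
have [b xb] := subdiff_fin subdiff_xbar.
move: cx; rewrite tiltedE// xb -EFinD lte_fin inner0l subr0 => cx.
have eta0 : 0 < c - (b + F (xbar, pbar)) by rewrite subr_gt0.
set eta := c - _ in eta0.
(* Changing [p] moves [F] by at most [L rho] at each of the two compared points, and the tilt
   contributes at most [rho gam]; the [1] makes the comparison with the gap strict. *)
have m0 : 0 < 2 * L + gam + 1 by rewrite ltr_wpDl// addr_ge0 ?mulr_ge0// ltW.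
pose rho := Num.min r (eta / (2 * L + gam + 1)).
have rho0 : 0 < rho by rewrite lt_min r_gt0 divr_gt0.
exists rho => [|v p x vr pr Mx]; first by rewrite rho0 ge_min lexx.
rewrite ltNge; apply/negP => gx.
have [/= bx _ xmin] := Mx.
have Ax : A x by apply: onA => //; rewrite -leNgt.
have prr : `|p - pbar| < r by apply: lt_le_trans pr _; rewrite ge_min lexx.
have xr : `|x - xbar| < r by rewrite Ax.
have xbr : `|xbar - xbar| < r by rewrite subrr normr0.
have bxbar : closed_ball xbar gam xbar.
  by apply/cballP; rewrite subrr normr0 ltW.
have := xmin _ bxbar; have := lt_le_trans cx1 (x1min x Ax).
rewrite !tiltedE ?xb; try exact: rU.
move: (g_noNy x); case: (g x) => [a||] // _; rewrite -!EFinD.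
rewrite lte_fin lee_fin inner0l subr0 => h1 h2.
have h3 := rL xr prr pbr; have h4 := rL xbr prr pbr.
have h5 := norm_inner_le v (x - xbar); rewrite Ax innerBr in h5.
move: h3 h4 h5; rewrite !ler_norml => /andP[h3 _] /andP[_ h4] /andP[_ h5].
have h6 : rho * (2 * L + gam + 1) <= eta.
  by rewrite -ler_pdivlMr// ge_min lexx orbT.
have h7 : L * `|p - pbar| <= L * rho by rewrite ler_wpM2l// ltW.
have h8 : `|v| * gam <= rho * gam by rewrite ler_wpM2r// ltW.
have h9 : c - (b + F (xbar, pbar)) <= 2 * (L * rho) + rho * gam.
  by move: h1 h2 h3 h4 h5 h7 h8; lra.
by move: h6 h9 rho0; rewrite /eta; lra.
Qed.

(** Minimisers are interior, hence satisfy the stationarity inclusion to which [rC] applies; at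
    equal parameters it forces them to coincide. *)
Lemma Mgamma_solution : exists rho : R, exists2 s : X * P -> X,
  0 < rho <= r & forall v p, `|v| < rho -> `|p - pbar| < rho ->
  [/\ Mgamma f g xbar gam (v, p) = [set s (v, p)],
      `|s (v, p) - xbar| < gam &
      forall v' p', `|v'| < rho -> `|p' - pbar| < rho ->
        `|s (v, p) - s (v', p')| <= C * (`|v - v'| + `|p - p'|)].
Proof.
have [rho rhor rhoP] := Mgamma_interior; have [rho0 rho_le] := andP rhor.
pose s q := xget 0 (Mgamma f g xbar gam q).
exists rho, s => //.
have sM v p : `|p - pbar| < rho -> Mgamma f g xbar gam (v, p) (s (v, p)).
  move=> pr; have [x Mx] := Mgamma_nonempty v (lt_le_trans pr rho_le).
  by apply: xgetPex; exists x.
have lip v p v' p' x x' : `|v| < rho -> `|p - pbar| < rho -> `|v'| < rho ->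
    `|p' - pbar| < rho -> Mgamma f g xbar gam (v, p) x ->
    Mgamma f g xbar gam (v', p') x' ->
    `|x - x'| <= C * (`|v - v'| + `|p - p'|).
  move=> vr pr vr' pr' Mx Mx'.
  have xg := rhoP _ _ _ vr pr Mx; have xg' := rhoP _ _ _ vr' pr' Mx'.
  have wide (t : R) : t < rho -> t < r by move=> /lt_le_trans; apply.
  apply: rC; try exact: wide; try exact: lt_trans gam_ltr.
    by apply: tilted_interior_subdiff => //; exact: wide.
  by apply: tilted_interior_subdiff => //; exact: wide.
move=> v p vr pr; split.
- apply/seteqP; split => [x Mx|x ->]; last exact: sM.
  have := lip v p v p _ _ vr pr vr pr Mx (sM v p pr).
  by rewrite !subrr !normr0 addr0 mulr0 normr_le0 subr_eq0 => /eqP.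
- exact: rhoP vr pr (sM v p pr).
by move=> v' p' vr' pr'; apply: lip => //; exact: sM.
Qed.

Lemma fully_stable_local : fully_stable f g pbar xbar.
Proof.
have [rho [s /andP[rho0 rho_le] sP]] := Mgamma_solution.
pose N := [set q : X * P | `|q - (0, pbar)| < rho].
have NE v p : N (v, p) -> `|v| < rho /\ `|p - pbar| < rho.
  rewrite /N/= prod_normE/= gt_max => /andP[].
  by rewrite -[(v, p).1 - _]/(v - 0) subr0.
have N0 : nbhs (0 : X, pbar) N.
  exact: (radius_near (Q := N) rho0 (fun _ h => h)).
have NP : N (0, pbar) by rewrite /N/= subrr normr0.
exists gam => //; split.
- exists N, s; split => //.
    by move=> [v p] /NE[vr pr]; have [] := sP v p vr pr.
  apply/lipschitzP; exists (C * 2) => -[v p] [v' p'] /NE[vr pr] /NE[vr' pr'].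
  have [_ _ /(_ _ _ vr' pr') h] := sP v p vr pr.
  apply: le_trans h _; rewrite -mulrA ler_wpM2l// mulrDl !mul1r.
  by apply: lerD; [exact: (norm_fst (_, _))|exact: (norm_snd (_, _))].
- pose mval (q : X * P) : R := fine (g (s q)) + (F (s q, q.2) - inner q.1 (s q)).
  have sgood v p : N (v, p) -> [/\ `|s (v, p) - xbar| < gam,
      g (s (v, p)) = (fine (g (s (v, p))))%:E,
      Mgamma f g xbar gam (v, p) (s (v, p)) &
      forall y, closed_ball xbar gam y ->
        ((mval (v, p))%:E <= tilted f g v p y)%E].
    move=> /NE[vr pr]; have [ME sg _] := sP v p vr pr.
    have Ms : Mgamma f g xbar gam (v, p) (s (v, p)) by rewrite ME.
    have pr' := lt_le_trans pr rho_le.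
    have [gv gvE] := subdiff_fin (tilted_interior_subdiff pr' sg Ms).
    have Usp : U (s (v, p), p) by apply: rU => //; exact: lt_trans gam_ltr.
    split => //; first by rewrite gvE.
    move=> y yb; have [/= _ _ /(_ y yb)] := Ms.
    by rewrite tiltedE// /mval/= gvE -EFinD.
  have mvalE v p : N (v, p) -> mgamma f g xbar gam (v, p) = (mval (v, p))%:E.
    move=> Nvp; have [sg gE Ms mle] := sgood v p Nvp.
    have [_ pr] := NE _ _ Nvp; have pr' := lt_le_trans pr rho_le.
    apply/le_anti/andP; split.
      apply: ereal_inf_lbound; exists (s (v, p)); first by case: Ms.
      have Usp : U (s (v, p), p) by apply: rU => //; exact: lt_trans gam_ltr.
      by rewrite /= tiltedE// gE.
    by apply: le_ereal_inf_tmp => _ [y yb <-]; exact: mle.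
  exists N, mval; split => //.
    move=> [v p] /mvalE ->; apply/seteqP; split => t /=; first by case.
    by move=> ->.
  apply/lipschitzP; exists (L + (`|xbar| + gam)).
  (* The minimiser for [(v', p')] competes in the problem for [(v, p)]: [g] cancels, [F] varies by
     [L |p - p'|] and the tilt by [|v - v'|] times the norm of a point of the ball. *)
  have half v p v' p' : N (v, p) -> N (v', p') ->
      mval (v, p) <= mval (v', p') + (L + (`|xbar| + gam)) * `|(v, p) - (v', p')|.
    move=> Nq Nq'; have [sg' gE' Ms' _] := sgood v' p' Nq'.
    have [_ _ _ mle] := sgood v p Nq.
    have [_ pr] := NE _ _ Nq; have [_ pr'] := NE _ _ Nq'.
    have {}pr := lt_le_trans pr rho_le; have {}pr' := lt_le_trans pr' rho_le.
    have sr' := lt_trans sg' gam_ltr.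
    have Usp := rU sr' pr; have := mle (s (v', p')); rewrite tiltedE// gE'.
    have bs : closed_ball xbar gam (s (v', p')) by case: Ms'.
    move=> /(_ bs); rewrite -EFinD lee_fin => h1; apply: le_trans h1 _.
    have h2 := rL sr' pr pr'.
    have h3 := norm_inner_le (v - v') (s (v', p')).
    have h4 : `|s (v', p')| <= `|xbar| + gam.
      rewrite -[s (v', p')](subrK xbar) addrC.
      by rewrite (le_trans (ler_normD _ _))// lerD2l ltW.
    have h5 : L * `|p - p'| <= L * `|(v, p) - (v', p')|.
      by rewrite ler_wpM2l//; exact: (norm_snd (_, _)).
    have h6 : `|v - v'| * `|s (v', p')| <=
        `|(v, p) - (v', p')| * (`|xbar| + gam).
      by apply: ler_pM => //; exact: (norm_fst (_, _)).
    have h7 : F (s (v', p'), p) - F (s (v', p'), p') <=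
        L * `|(v, p) - (v', p')|.
      exact: le_trans (le_trans (ler_norm _) h2) h5.
    have h8 : - inner (v - v') (s (v', p')) <=
        `|(v, p) - (v', p')| * (`|xbar| + gam).
      apply: le_trans h6; apply: le_trans h3.
      by rewrite -normrN; exact: ler_norm.
    rewrite innerBl in h8; rewrite /mval/=.
    move: h7 h8; set n := `|_ - _|; set F1 := F _; set F2 := F _.
    set i1 := inner _ _; set i2 := inner _ _; set g1 := fine _.
    set B := _ + gam; move: n F1 F2 i1 i2 g1 B => n F1 F2 i1 i2 g1 B.
    lra.
  move=> [v p] [v' p'] Nq Nq'; rewrite ler_norml.
  have h1 := half _ _ _ _ Nq Nq'; have := half _ _ _ _ Nq' Nq.
  rewrite distrC => h2; apply/andP; split; last by rewrite lerBlDl.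
  by rewrite lerNl opprB lerBlDl.
have [ME _ _] := sP 0 pbar (NE _ _ NP).1 (NE _ _ NP).2.
have Mx : Mgamma f g xbar gam (0, pbar) xbar.
  split => /=; first by apply/cballP; rewrite subrr normr0 ltW.
    by apply: tilted_xbar_fin; rewrite subrr normr0.
  by move=> y _; exact: xbar_tilted.
by move: Mx; rewrite ME => ->.
Qed.

Lemma solution_map_local : (\forall p \near pbar, convex_fun (fun x => f (x, p))) ->
  single_valued_lipschitz_around (solution_map f g) pbar /\
  solution_map f g pbar = [set xbar].
Proof.
move=> fC; have [rho [s /andP[rho0 rho_le] sP]] := Mgamma_solution.
have [r1 r10 r1P] := near_radius fC.
pose N := [set p : P | `|p - pbar| < Num.min rho r1].
have n0 : `|0 : X| < rho by rewrite normr0.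
have SE p : N p -> solution_map f g p = [set s (0, p)].
  rewrite /N/= lt_min => /andP[pr pr1].
  have [ME sg _] := sP 0 p n0 pr.
  have pr' := lt_le_trans pr rho_le.
  have sr := lt_trans sg gam_ltr.
  have Usp : U (s (0, p), p) by exact: rU.
  have Ms : Mgamma f g xbar gam (0, p) (s (0, p)) by rewrite ME.
  have gsub := tilted_interior_subdiff pr' sg Ms.
  have fsub := f_subdiff (fun _ => f_noNy _) (r1P p pr1) Usp.
  have [b gb] := subdiff_fin gsub.
  (* Convexity of [f (., p)] makes the minimiser over the ball global: its subgradients for
     [f (., p)] and [g] are opposite. *)
  have sol : solution_map f g p (s (0, p)).
    split => //; first by rewrite gb fE// -EFinD ltry.
    move=> y _; rewrite gb fE//.
    have := f_noNy (y, p); have := g_noNy y.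
    case fz : (f (y, p)) => [fr||] //; case gz : (g y) => [gr||] //= _ _;
      rewrite ?leey//.
    rewrite -!EFinD lee_fin.
    have h1 := subdiffP fsub (fE Usp) fz; have h2 := subdiffP gsub gb gz.
    rewrite innerBl inner0l sub0r in h2.
    have := lerD h1 h2; rewrite addrACA subrr addr0.
    by [].
  apply/seteqP; split => [y [_ _ ymin]|y ->//].
  by apply: (convex_argmin_unique pr' sr (r1P p pr1) sol); exact: ymin.
have Npbar : N pbar by rewrite /N/= subrr normr0 lt_min rho0.
split.
  exists N, (fun p => s (0, p)); split => //.
    by apply: (radius_near (r := Num.min rho r1)) => //; rewrite lt_min rho0.
  apply/lipschitzP; exists C => p p'; rewrite /N/= !lt_min.
  move=> /andP[pr _] /andP[pr' _].
  have [_ _ /(_ _ _ n0 pr')] := sP 0 p n0 pr.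
  by rewrite subrr normr0 add0r.
have : solution_map f g pbar xbar by exact: xbar_opt.
by rewrite SE// => ->.
Qed.

End LocalAnalysis.

Lemma fully_stable_of_kernel : fully_stable f g pbar xbar.
Proof.
have [r [C [L [r0 C0 L0 rU [rC rL]]]]] := good_radius.
exact: (fully_stable_local r0 C0 L0 rU rC rL).
Qed.

Lemma solution_map_of_kernel :
  (\forall p \near pbar, convex_fun (fun x => f (x, p))) ->
  single_valued_lipschitz_around (solution_map f g) pbar /\
  solution_map f g pbar = [set xbar].
Proof.
have [r [C [L [r0 C0 L0 rU [rC rL]]]]] := good_radius.
exact: (solution_map_local r0 L0 rU rC rL).
Qed.

End Sensitivity.

Lemma fully_stable_tilt_stable (R : realType) (X P : euclidType R)
    (f : X * P -> \bar R) (g : X -> \bar R) (pbar : P) (xbar : X) :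
  fully_stable f g pbar xbar -> tilt_stable f g pbar xbar.
Proof.
move=> [gam gam0 [[N [s [N0 NM /lipschitzP[K KP]]]] _ Mx]].
exists gam => //; split=> //.
have [r r0 rP] := near_radius N0.
exists [set v | `|v - 0| < r], (fun v => s (v, pbar)).
have vN v : `|v - 0| < r -> N (v, pbar).
  by move=> vr; apply: rP; rewrite subr_pair norm_pair0.
split=> [|v /vN/NM//|]; first exact: (radius_near r0 (fun _ h => h)).
apply/lipschitzP; exists K => v v' /vN Nv /vN Nv'.
by apply: le_trans (KP _ _ Nv Nv') _; rewrite subr_pair norm_pair0.
Qed.

Theorem theorem4p4 (R : realType) (X P : euclidType R)
    (f : X * P -> \bar R) (g : X -> \bar R) (pbar : P) (xbar zbar : X)
    (f_noNy : noNy f) (g_noNy : noNy g)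
    (g_closed : closed_fun g) (g_proper : proper_fun g) (g_convex : convex_fun g)
    (xbar_dom : (dom (fun x => f (x, pbar)) `&` dom g) xbar)
    (xbar_opt : argmin (fun x => f (x, pbar) + g x)%E [set: X] xbar)
    (f_convex : convex_fun (fun x => f (x, pbar)))
    (f_C2 : exists U : set (X * P),
       [/\ open_nbhs (xbar, pbar) U, forall q, U q -> f q \is a fin_num &
           C2_on (fun q => fine (f q)) U])
    (zbarE : zbar = - grad (fun x => fine (f (x, pbar))) xbar)
    (g_reducible : C2_cone_reducible_fun (conjugate g) zbar) :
  let cond_iii :=
    [set w | hess (fun x => fine (f (x, pbar))) xbar w = 0]
      `&` par (subdiff (conjugate g) zbar) = [set 0] in
  [/\ fully_stable f g pbar xbar <-> tilt_stable f g pbar xbar,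
      tilt_stable f g pbar xbar <-> cond_iii &
      (\forall p \near pbar, convex_fun (fun x => f (x, p))) -> cond_iii ->
        single_valued_lipschitz_around (solution_map f g) pbar /\
        solution_map f g pbar = [set xbar]].
Proof.
Proof.
move=> cond_iii; have [U [aU f_fin F_C2]] := f_C2.
pose F q := fine (f q).
have F_C1 : C1_on F U by exact: C2_C1.
have [G GE G_C1] := partial_gradient aU.1 F_C2.
have Ua : U (xbar, pbar) by case: aU.
pose H : {linear X -> X} := 'd (grad (fun x => F (x, pbar))) xbar.
have HE u : H u = 'd G (xbar, pbar) (u, 0).
  apply: (hess_slice u GE aU) => [q /F_C1[]//|].
  by have [] := G_C1 _ Ua.
have zbarG : zbar = - G (xbar, pbar).
  by rewrite zbarE (grad_slice GE (F_C1 _ Ua).1).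
have zx := subdiff_xbar g_noNy g_convex xbar_dom xbar_opt aU f_fin F_C1 GE zbarG.
have xz := subdiff_conjugate zx.
have FC : convex_combination_closed (subdiff (conjugate g) zbar).
  move=> u v t t01; apply: subdiff_convex => //.
  exact: conjugate_noNy zx.
(* Convexity of the subdifferential turns [par] into scaled differences, and [0] always belongs to
   the intersection, so (iii) reduces to an implication. *)
have condP : cond_iii <->
    forall w, H w = 0 -> scaled_diff (subdiff (conjugate g) zbar) w -> w = 0.
  rewrite /cond_iii (par_scaled_diff FC); split=> [E w Hw Dw|K].
    have : [set 0] w by rewrite -E.
    by [].
  apply/seteqP; split=> [w [Hw Dw]|_ ->]; first exact: K.
  split; first exact: linear0.
  by exists 0 => //; exists xbar, xbar; rewrite scale0r.
have iii_i : cond_iii -> fully_stable f g pbar xbar.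
  move=> /condP K.
  exact: (fully_stable_of_kernel f_noNy g_noNy g_closed g_convex xbar_dom xbar_opt
    f_convex aU f_fin F_C1 GE G_C1 HE zbarG).
have ii_iii : tilt_stable f g pbar xbar -> cond_iii.
  move=> ts; apply/condP => w.
  exact: (tilt_stable_kernel f_noNy g_noNy g_closed g_convex xbar_dom xbar_opt
    f_convex aU f_fin F_C1 GE G_C1 HE zbarG ts).
split.
- by split; [exact: fully_stable_tilt_stable|move=> /ii_iii/iii_i].
- by split=> [|/iii_i]; [exact: ii_iii|exact: fully_stable_tilt_stable].
move=> fC /condP K.
exact: (solution_map_of_kernel f_noNy g_noNy g_closed g_convex xbar_dom xbar_opt
  f_convex aU f_fin F_C1 GE G_C1 HE zbarG).
Qed.
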